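(* Let $(R,\mathfrak m)$ be a Cohen--Macaulay local ring and let $\mathfrak p$ be a prime ideal of $R$ of height $g$ such that $R_{\mathfrak p}$ is not a regular local ring. Let $z_1,\ldots,z_g$ be a regular sequence contained in $\mathfrak p$, and set $J=(z_1,\ldots,z_g)$. Then the link $I=J\colon \mathfrak p$ is an equimultiple ideal with reduction number $1$.
   Context: All rings are Noetherian. A reduction of an ideal $I$ is an ideal $J\subset I$ such that $I^{n+1}=JI^n$ for some integer $n\ge 0$; the least such $n$ is denoted $r_J(I)$, the reduction number of $I$ with respect to $J$. A minimal reduction is a reduction minimal with respect to inclusion. The reduction number of $I$ is the minimum of $r_J(I)$ over all minimal reductions $J$ of $I$. The analytic spread $\ell(I)$ is the Krull dimension of the fibre ring $R[It]\otimes_R R/\mathfrak m$, where $R[It]=\bigoplus_{i\ge 0}I^it^i$ is the Rees algebra of $I$. The ideal $I$ is equimultiple if $\ell(I)=\mathrm{height}(I)$ (i.e. its analytic deviation $\ell(I)-\mathrm{height}(I)$ is zero). *)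

(* Defs.v *)
From HB Require Import structures.
From mathcomp Require Import all_boot all_order all_algebra.
From mathcomp Require Import generic_quotient ring_quotient ring.
From mathcomp Require Import boolp classical_sets.

Set Implicit Arguments.
Unset Strict Implicit.
Unset Printing Implicit Defensive.

Import GRing.Theory.
Local Open Scope classical_set_scope.
Local Open Scope ring_scope.
Local Open Scope quotient_scope.

Identity Coercion fun_of_set : set >-> Funclass.

(* MathComp's [idealr] only covers proper ideals given by boolean predicates;
   powers [I^0 = (1)] and colons need the unit ideal as well, hence this
   structure. Correspondingly the carrier rings below are possibly trivial
   ([comPzRingType]) wherever a quotient could collapse. *)
Definition ideal_closed (A : comPzRingType) (S : set A) : Prop :=
  [/\ S 0, (forall x y, S x -> S y -> S (x + y))
    & forall a x, S x -> S (a * x)].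

Record ideal (A : comPzRingType) := Ideal {
  ideal_set :> set A;
  idealP : ideal_closed ideal_set
}.

Lemma ideal_eq (A : comPzRingType) (I J : ideal A) :
  I = J :> set A -> I = J.
Proof.
case: I J => [S hS] [T hT] /= eST; rewrite -{}eST in hT *.
by rewrite (Prop_irrelevance hS hT).
Qed.

Section IdealConstructions.
Variable A : comPzRingType.
Implicit Types (I J K : ideal A) (S : set A).

Lemma ideal0 I : I 0. Proof. by case: (idealP I). Qed.
Lemma idealD I x y : I x -> I y -> I (x + y).
Proof. by case: (idealP I) => _ + _; apply. Qed.
Lemma idealM I a x : I x -> I (a * x).
Proof. by case: (idealP I) => _ _; apply. Qed.
Lemma idealN I x : I x -> I (- x).
Proof. by move=> Ix; rewrite -mulN1r; apply: idealM. Qed.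

Lemma unit_ideal_closed : ideal_closed [set: A].
Proof. by split. Qed.
Definition unit_ideal : ideal A := Ideal unit_ideal_closed.

Lemma ideal_span_closed S :
  ideal_closed [set x | forall K, S `<=` K -> K x].
Proof.
split=> [K _|x y Hx Hy K SK|a x Hx K SK]; first exact: ideal0.
- by apply: idealD; [apply: Hx|apply: Hy].
- by apply: idealM; apply: Hx.
Qed.
Definition ideal_span S : ideal A := Ideal (ideal_span_closed S).

Lemma sub_ideal_span S : S `<=` ideal_span S.
Proof. by move=> x Sx K; apply. Qed.

Definition ideal_mul I J : ideal A :=
  ideal_span [set x * y | x in I & y in J].

Fixpoint ideal_exp I (n : nat) : ideal A :=
  if n is n'.+1 then ideal_mul I (ideal_exp I n') else unit_ideal.

Lemma ideal_colon_closed J I :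
  ideal_closed [set x | forall y, I y -> J (x * y)].
Proof.
split=> [y _|x x' Hx Hx' y Iy|a x Hx y Iy].
- by rewrite mul0r; apply: ideal0.
- by rewrite mulrDl; apply: idealD; [apply: Hx|apply: Hx'].
- by rewrite -mulrA; apply: idealM; apply: Hx.
Qed.
(* [J : I] *)
Definition ideal_colon J I : ideal A := Ideal (ideal_colon_closed J I).

Definition prime_ideal I : Prop :=
  ~ I 1 /\ forall x y, I (x * y) -> I x \/ I y.

Definition maximal_ideal I : Prop :=
  ~ I 1 /\ forall J, I `<=` J -> ~ J 1 -> J = I.

(* [P 0 < P 1 < ... < P n], a chain of primes of length [n] *)
Definition prime_chain (n : nat) (P : nat -> ideal A) : Prop :=
  (forall i, (i <= n)%N -> prime_ideal (P i)) /\
  (forall i, (i < n)%N -> P i `<` P i.+1).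

(* Possibly infinite invariants are relations with their finite value:
   [height I n], [depth I n], [krull_dim A n], [analytic_spread I m n], ...
   read "is finite and equal to [n]". *)
Definition prime_height I (n : nat) : Prop :=
  (exists2 P, prime_chain n P & P n = I) /\
  forall k P, prime_chain k P -> P k = I -> (k <= n)%N.

Definition height I (n : nat) : Prop :=
  (exists Q, [/\ prime_ideal Q, I `<=` Q & prime_height Q n]) /\
  forall Q k, prime_ideal Q -> I `<=` Q -> prime_height Q k -> (n <= k)%N.

(* regular sequence on [A], including [(z) <> A] *)
Definition regular_sequence (z : seq A) : Prop :=
  (forall i x, (i < size z)%N ->
     ideal_span [set` take i z] (z`_i * x) -> ideal_span [set` take i z] x) /\
  ~ ideal_span [set` z] 1.

(* depth of [A] with respect to [I]: the longest regular sequence in [I] *)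
Definition depth I (n : nat) : Prop :=
  (exists z : seq A, [/\ regular_sequence z, [set` z] `<=` I & size z = n]) /\
  forall z : seq A, regular_sequence z -> [set` z] `<=` I -> (size z <= n)%N.

End IdealConstructions.

Definition krull_dim (A : comPzRingType) (n : nat) : Prop :=
  (exists P : nat -> ideal A, prime_chain n P) /\
  forall k (P : nat -> ideal A), prime_chain k P -> (k <= n)%N.

Definition noetherian (A : comPzRingType) : Prop :=
  forall I : ideal A, exists s : seq A, I = ideal_span [set` s].

Definition local_ring (A : comPzRingType) (m : ideal A) : Prop :=
  maximal_ideal m /\ forall n : ideal A, maximal_ideal n -> n = m.

Definition cohen_macaulay_local (A : comPzRingType) (m : ideal A) : Prop :=
  [/\ noetherian A, local_ring m & exists2 d, depth m d & krull_dim A d].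

(* Noetherian local, with maximal ideal generated by [dim A] elements *)
Definition regular_local_ring (A : comPzRingType) : Prop :=
  noetherian A /\
  exists m : ideal A, local_ring m /\
    exists2 s : seq A, m = ideal_span [set` s] & krull_dim A (size s).

Section QuotientRing.
Variables (A : comPzRingType) (I : ideal A).

Definition ideal_pred : {pred A} := fun x => `[< I x >].

Lemma ideal_pred_zmod_closed : zmod_closed ideal_pred.
Proof.
split=> [|x y /asboolP Ix /asboolP Iy]; apply/asboolP; first exact: ideal0.
by apply: idealD => //; apply: idealN.
Qed.
HB.instance Definition _ :=
  GRing.isZmodClosed.Build A ideal_pred ideal_pred_zmod_closed.

Definition quotient_ring : Type := Quotient.quot ideal_pred.
HB.instance Definition _ := GRing.Zmodule.on quotient_ring.

Definition to_quotient (x : A) : quotient_ring :=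
  \pi_(Quotient.quot ideal_pred) x.

Lemma to_quotientK (x : quotient_ring) : to_quotient (repr x) = x.
Proof. by rewrite /to_quotient reprK. Qed.

Lemma to_quotient_eq x y : I (x - y) -> to_quotient x = to_quotient y.
Proof. by move=> h; apply/eqmodP/asboolP. Qed.

Lemma to_quotient_repr x : I (repr (to_quotient x) - x).
Proof.
have : to_quotient (repr (to_quotient x)) = to_quotient x.
  by rewrite to_quotientK.
by move=> /eqmodP /asboolP.
Qed.

Lemma to_quotientD x y : to_quotient (x + y) = to_quotient x + to_quotient y.
Proof. by rewrite /to_quotient raddfD. Qed.

Definition quotient_one : quotient_ring := to_quotient 1.
Definition quotient_mul (x y : quotient_ring) : quotient_ring :=
  to_quotient (repr x * repr y).

Lemma to_quotientM x y :
  quotient_mul (to_quotient x) (to_quotient y) = to_quotient (x * y).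
Proof.
apply: to_quotient_eq.
have -> : repr (to_quotient x) * repr (to_quotient y) - x * y
        = repr (to_quotient x) * (repr (to_quotient y) - y)
          + y * (repr (to_quotient x) - x).
  by rewrite !mulrBr addrA (mulrC y) subrK (mulrC y).
by apply: idealD; apply: idealM; apply: to_quotient_repr.
Qed.

Lemma quotient_mulA : associative quotient_mul.
Proof.
move=> x y z; rewrite -(to_quotientK x) -(to_quotientK y) -(to_quotientK z).
by rewrite !to_quotientM mulrA.
Qed.
Lemma quotient_mulC : commutative quotient_mul.
Proof.
move=> x y; rewrite -(to_quotientK x) -(to_quotientK y).
by rewrite !to_quotientM mulrC.
Qed.
Lemma quotient_mul1 : left_id quotient_one quotient_mul.
Proof. by move=> x; rewrite -(to_quotientK x) to_quotientM mul1r. Qed.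
Lemma quotient_mulDl : left_distributive quotient_mul +%R.
Proof.
move=> x y z; rewrite -(to_quotientK x) -(to_quotientK y) -(to_quotientK z).
by rewrite -to_quotientD !to_quotientM mulrDl to_quotientD.
Qed.

HB.instance Definition _ := GRing.Zmodule_isComPzRing.Build quotient_ring
  quotient_mulA quotient_mulC quotient_mul1 quotient_mulDl.

End QuotientRing.

Section Localization.
Variables (A : comPzRingType) (p : ideal A) (hp : prime_ideal p).

Definition denominator (_ : prime_ideal p) := {s : A | s \notin ideal_pred p}.
Definition fraction := (A * denominator hp)%type.
Implicit Types (f g h : fraction).

Lemma denominatorP (s : A) : reflect (~ p s) (s \notin ideal_pred p).
Proof. by apply: (iffP negP) => h /asboolP. Qed.

Definition frac_den f : A := val f.2.

Lemma frac_denN f : ~ p (frac_den f).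
Proof. exact/denominatorP/(valP f.2). Qed.

Lemma prime_complM s t : ~ p s -> ~ p t -> ~ p (s * t).
Proof. by case: hp => _ pM hs ht /pM []. Qed.

Definition mk_frac (a s : A) (hs : ~ p s) : fraction :=
  (a, exist _ s (introT (denominatorP s) hs)).

Lemma frac_denMN f g : ~ p (frac_den f * frac_den g).
Proof. exact: prime_complM (@frac_denN f) (@frac_denN g). Qed.

(* a/s = b/t iff u(at - bs) = 0 for some u outside p *)
Definition fraction_equiv f g : bool :=
  `[< exists2 u, ~ p u & u * (f.1 * val g.2 - g.1 * val f.2) = 0 >].

Lemma fraction_equivP f g : reflect
  (exists2 u, ~ p u & u * (f.1 * frac_den g) = u * (g.1 * frac_den f))
  (fraction_equiv f g).
Proof.
apply: (iffP (asboolP _)) => -[u hu e]; exists u => //.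
  by apply/eqP; rewrite -subr_eq0 -mulrBr e.
by rewrite mulrBr -/(frac_den g) e subrr.
Qed.

Lemma fraction_equiv_refl : reflexive fraction_equiv.
Proof. by move=> f; apply/fraction_equivP; exists 1 => //; case: hp. Qed.
Lemma fraction_equiv_sym : symmetric fraction_equiv.
Proof.
by move=> f g; apply/fraction_equivP/fraction_equivP => -[u hu e]; exists u.
Qed.
Lemma fraction_equiv_trans : transitive fraction_equiv.
Proof.
move=> g f h /fraction_equivP[u hu e] /fraction_equivP[v hv e'].
apply/fraction_equivP.
exists (u * v * frac_den g).
  by apply: prime_complM; [apply: prime_complM|apply: frac_denN].
have -> : u * v * frac_den g * (f.1 * frac_den h)
  = v * frac_den h * (u * (f.1 * frac_den g)).
  by ring.
have -> : u * v * frac_den g * (h.1 * frac_den f)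
  = u * frac_den f * (v * (h.1 * frac_den g)).
  by ring.
by rewrite e -e'; ring.
Qed.

Canonical fraction_equiv_rel := EquivRel fraction_equiv
  fraction_equiv_refl fraction_equiv_sym fraction_equiv_trans.

Definition localization : Type := {eq_quot fraction_equiv}.
HB.instance Definition _ := Choice.on localization.

Definition to_loc (f : fraction) : localization :=
  \pi_({eq_quot fraction_equiv}) f.

Lemma to_locK (x : localization) : to_loc (repr x) = x.
Proof. by rewrite /to_loc reprK. Qed.

Lemma to_loc_eq f g :
  (exists2 u, ~ p u & u * (f.1 * frac_den g) = u * (g.1 * frac_den f)) ->
  to_loc f = to_loc g.
Proof. by move=> h; apply/eqmodP/fraction_equivP. Qed.

Lemma to_loc_repr f : exists2 u, ~ p u &
  u * ((repr (to_loc f)).1 * frac_den f)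
    = u * (f.1 * frac_den (repr (to_loc f))).
Proof. by apply/fraction_equivP; have /eqmodP := to_locK (to_loc f). Qed.

Definition frac0 : fraction := mk_frac 0 hp.1.
Definition frac1 : fraction := mk_frac 1 hp.1.
Definition frac_opp f : fraction := mk_frac (- f.1) (@frac_denN f).
Definition frac_add f g : fraction :=
  mk_frac (f.1 * frac_den g + g.1 * frac_den f) (@frac_denMN f g).
Definition frac_mul f g : fraction :=
  mk_frac (f.1 * g.1) (@frac_denMN f g).

Definition loc_zero : localization := to_loc frac0.
Definition loc_one : localization := to_loc frac1.
Definition loc_opp (x : localization) : localization :=
  to_loc (frac_opp (repr x)).
Definition loc_add (x y : localization) : localization :=
  to_loc (frac_add (repr x) (repr y)).
Definition loc_mul (x y : localization) : localization :=
  to_loc (frac_mul (repr x) (repr y)).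

Lemma to_locN f : loc_opp (to_loc f) = to_loc (frac_opp f).
Proof.
apply: to_loc_eq; have [u hu e] := to_loc_repr f; exists u => //.
by rewrite /= !mulNr !mulrN; congr (- _).
Qed.

Lemma to_loc2 (op : fraction -> fraction -> fraction) f g :
  (forall f' g' u v,
     u * (f'.1 * frac_den f) = u * (f.1 * frac_den f') ->
     v * (g'.1 * frac_den g) = v * (g.1 * frac_den g') ->
     u * v * ((op f' g').1 * frac_den (op f g)) =
     u * v * ((op f g).1 * frac_den (op f' g'))) ->
  to_loc (op (repr (to_loc f)) (repr (to_loc g))) = to_loc (op f g).
Proof.
move=> H; apply: to_loc_eq.
have [u hu e] := to_loc_repr f; have [v hv e'] := to_loc_repr g.
by exists (u * v); [apply: prime_complM|apply: H].
Qed.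

Lemma to_locD f g : loc_add (to_loc f) (to_loc g) = to_loc (frac_add f g).
Proof.
apply: (to_loc2 (op := frac_add)) => f' g' u v e e'; rewrite /= /frac_den /=.
rewrite -!/(frac_den _).
have -> : u * v * ((f'.1 * frac_den g' + g'.1 * frac_den f')
                    * (frac_den f * frac_den g))
  = v * frac_den g' * frac_den g * (u * (f'.1 * frac_den f))
    + u * frac_den f' * frac_den f * (v * (g'.1 * frac_den g)) by ring.
by rewrite e e'; ring.
Qed.

Lemma to_locM f g : loc_mul (to_loc f) (to_loc g) = to_loc (frac_mul f g).
Proof.
apply: (to_loc2 (op := frac_mul)) => f' g' u v e e'; rewrite /= /frac_den /=.
rewrite -!/(frac_den _).
have -> : u * v * (f'.1 * g'.1 * (frac_den f * frac_den g))
  = (u * (f'.1 * frac_den f)) * (v * (g'.1 * frac_den g)) by ring.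
by rewrite e e'; ring.
Qed.

Lemma to_loc_ext f g :
  f.1 * frac_den g = g.1 * frac_den f -> to_loc f = to_loc g.
Proof. by move=> e; apply: to_loc_eq; exists 1; [exact: hp.1|rewrite e]. Qed.

Lemma loc_addA : associative loc_add.
Proof.
move=> x y z; rewrite -(to_locK x) -(to_locK y) -(to_locK z) !to_locD.
apply: to_loc_ext.
by rewrite /=; do 3 rewrite /frac_den /=; ring.
Qed.
Lemma loc_addC : commutative loc_add.
Proof.
move=> x y; rewrite -(to_locK x) -(to_locK y) !to_locD.
apply: to_loc_ext.
by rewrite /=; do 3 rewrite /frac_den /=; ring.
Qed.
Lemma loc_add0 : left_id loc_zero loc_add.
Proof.
move=> x; rewrite -(to_locK x) to_locD; apply: to_loc_ext.
by rewrite /=; do 3 rewrite /frac_den /=; ring.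
Qed.
Lemma loc_addN : left_inverse loc_zero loc_opp loc_add.
Proof.
move=> x; rewrite -(to_locK x) to_locN to_locD; apply: to_loc_ext.
by rewrite /=; do 3 rewrite /frac_den /=; ring.
Qed.
HB.instance Definition _ := GRing.isZmodule.Build localization
  loc_addA loc_addC loc_add0 loc_addN.

Lemma loc_mulA : associative loc_mul.
Proof.
move=> x y z; rewrite -(to_locK x) -(to_locK y) -(to_locK z) !to_locM.
apply: to_loc_ext.
by rewrite /=; do 3 rewrite /frac_den /=; ring.
Qed.
Lemma loc_mulC : commutative loc_mul.
Proof.
move=> x y; rewrite -(to_locK x) -(to_locK y) !to_locM.
apply: to_loc_ext.
by rewrite /=; do 3 rewrite /frac_den /=; ring.
Qed.
Lemma loc_mul1 : left_id loc_one loc_mul.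
Proof.
move=> x; rewrite -(to_locK x) to_locM; apply: to_loc_ext.
by rewrite /=; do 3 rewrite /frac_den /=; ring.
Qed.
Lemma loc_mulDl : left_distributive loc_mul +%R.
Proof.
move=> x y z; rewrite -(to_locK x) -(to_locK y) -(to_locK z).
change (loc_mul (loc_add (to_loc (repr x)) (to_loc (repr y))) (to_loc (repr z)) =
  loc_add (loc_mul (to_loc (repr x)) (to_loc (repr z)))
          (loc_mul (to_loc (repr y)) (to_loc (repr z)))).
rewrite to_locD !to_locM to_locD; apply: to_loc_ext.
by rewrite /=; do 3 rewrite /frac_den /=; ring.
Qed.
HB.instance Definition _ := GRing.Zmodule_isComPzRing.Build localization
  loc_mulA loc_mulC loc_mul1 loc_mulDl.

End Localization.

Section Rees.
Variables (R : comNzRingType) (I : ideal R).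

(* the Rees algebra R[It], as the subring of R[t] of the polynomials whose
   coefficient of degree i lies in I^i *)
Definition rees_pred : {pred {poly R}} :=
  fun f => `[< forall i, ideal_exp I i f`_i >].

Lemma ideal_mulP (J K : ideal R) x y : J x -> K y -> ideal_mul J K (x * y).
Proof. by move=> Jx Ky; apply: sub_ideal_span; exists x => //; exists y. Qed.

Lemma ideal_exp_mul i j x y :
  ideal_exp I i x -> ideal_exp I j y -> ideal_exp I (i + j) (x * y).
Proof.
elim: i x y => [|i IHi] x y /=; first by move=> _; apply: idealM.
move=> Ix Jy; move: y Jy.
have Ex : ideal_colon (ideal_exp I (i.+1 + j)) (ideal_exp I j) x.
  2: exact: Ex.
apply: Ix => _ [a Ia [b Ib <-]] w Jw.
by rewrite -mulrA; apply: ideal_mulP => //; apply: IHi.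
Qed.

Lemma rees_subring_closed : subring_closed rees_pred.
Proof.
split=> [|f g /asboolP If /asboolP Ig|f g /asboolP If /asboolP Ig];
  apply/asboolP => i.
- by rewrite coef1; case: i => [|i] //; apply: ideal0.
- by rewrite coefB; apply: idealD => //; apply: idealN.
rewrite coefM; elim/big_ind: _ => [||j _]; [exact: ideal0|exact: idealD|].
by rewrite -[i in ideal_exp I i](subnKC (ltn_ord j : (j <= i)%N));
   apply: ideal_exp_mul.
Qed.
HB.instance Definition _ :=
  GRing.isSubringClosed.Build {poly R} rees_pred rees_subring_closed.

Record rees_algebra := ReesAlgebra {
  rees_val :> {poly R};
  _ : rees_val \in rees_pred
}.
HB.instance Definition _ := [isSub for rees_val].
HB.instance Definition _ := [Choice of rees_algebra by <:].
HB.instance Definition _ :=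
  [SubChoice_isSubComNzRing of rees_algebra by <:].

(* R[It] (x)_R R/m, realized as R[It] / m R[It] *)
Definition fibre_ring (m : ideal R) : comPzRingType :=
  quotient_ring (ideal_span
    [set f : rees_algebra | exists2 a, m a & rees_val f = a%:P]).

Definition analytic_spread (m : ideal R) (n : nat) : Prop :=
  krull_dim (fibre_ring m) n.

Definition equimultiple (m : ideal R) : Prop :=
  exists2 n, analytic_spread m n & height I n.

End Rees.

Section Reductions.
Variables (R : comPzRingType).
Implicit Types (I J K : ideal R).

Definition reduction J I : Prop :=
  J `<=` I /\
  exists n, ideal_exp I n.+1 = ideal_mul J (ideal_exp I n).

(* [r_J(I) = n] *)
Definition reduction_number_wrt J I (n : nat) : Prop :=
  ideal_exp I n.+1 = ideal_mul J (ideal_exp I n) /\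
  forall k, ideal_exp I k.+1 = ideal_mul J (ideal_exp I k) -> (n <= k)%N.

Definition minimal_reduction J I : Prop :=
  reduction J I /\ forall K, reduction K I -> K `<=` J -> K = J.

Definition reduction_number I (n : nat) : Prop :=
  (exists2 J, minimal_reduction J I & reduction_number_wrt J I n) /\
  forall J k, minimal_reduction J I -> reduction_number_wrt J I k -> (n <= k)%N.

End Reductions.

(* Main.v *)
(** Let [x, y] be in the link [I = J : p] and write [x y = sum a_i z_i]. For
    [c] in [p], write [c x = sum b_i z_i]. Every [b_i] lies in [p], since a
    [b_i] outside [p] would let [c] replace [z_i] and make [R_p] regular.
    Comparing coefficients modulo [J] gives [c a_i = b_i y = 0], so each [a_i]
    lies in [I] and [I^2 = J I]. Moreover [I <> J] since [p] is minimal over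
    [J], and [p] is itself a prime of height [g] containing [I].

    The fibre ring is finite over the subalgebra generated by the classes of
    the [z_i t]. Counting monomials, its dimension is at most the number of
    generators of any ideal that is a reduction of [I] modulo [m I]; this
    bounds [l(I)] by [g] and, once [l(I) = g] is known, forbids a reduction
    properly inside [J], whose image in [J / m J] would be spanned by fewer
    than [g] elements. Conversely the [z_i t] form a regular sequence on
    [R[Jt] / m R[Jt]], and going up along [R[Jt] <= R[It]] produces a chain of
    [g + 1] primes in the fibre ring. *)

Require Import Defs.
From mathcomp Require Import all_boot all_order all_algebra.
From mathcomp Require Import ring.
From mathcomp Require Import boolp classical_sets.

Set Implicit Arguments.
Unset Strict Implicit.
Unset Printing Implicit Defensive.

Import GRing.Theory.
Local Open Scope classical_set_scope.
Local Open Scope ring_scope.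

(** * Ideals and primes *)

(** Heights and Krull dimensions are only ever compared with lengths of prime chains. For heights
    the one tool is that a prime containing a regular sequence of length g is the top of a chain of
    length g; it yields the height of [I] and the minimality of [p] over [J].

    The lower bound on the analytic spread has to cross from R[Jt], where regularity gives control,
    to R[It], where the primes must live. The subrings R[(s)t] are never made into rings: [coef_in]
    describes them by coefficients inside R[It], and the chain grows upwards from [rees_max I m] by
    avoiding multiplicative sets contained in these subrings. Contraction to a subring is replaced
    by the determinant trick, which moves a power of an element into the right ideal; a power is
    enough because the avoided sets are multiplicative.

    For the upper bound the residue field is not formed either: an element outside [m] is a unit,
    which is all that elimination needs. N^(h+1) monomials are compared with |E| M^h spanning
    elements, M being linear in N, so crude degree bounds suffice. *)

Section Ideals.
Variable A : comPzRingType.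
Implicit Types (I J K L Q : ideal A) (S : set A) (s t : seq A) (P : nat -> ideal A).

Lemma idealB I x y : I x -> I y -> I (x - y).
Proof. by move=> Ix Iy; apply: idealD => //; apply: idealN. Qed.

Lemma idealMr I x a : I x -> I (x * a).
Proof. by rewrite mulrC; apply: idealM. Qed.

Lemma idealDr I x y : I x -> I (x + y) -> I y.
Proof. by move=> Ix Ixy; rewrite -[y](addKr x) addrC; apply: idealB. Qed.

Lemma ideal_sum I (T : Type) (r : seq T) (b : pred T) (F : T -> A) :
  (forall i, b i -> I (F i)) -> I (\sum_(i <- r | b i) F i).
Proof.
by move=> IF; elim/big_ind: _ => //; [apply: ideal0|move=> x y; apply: idealD].
Qed.

Lemma ideal_le_anti I J : I `<=` J -> J `<=` I -> I = J.
Proof. by move=> IJ JI; apply/ideal_eq/seteqP. Qed.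

Lemma ideal_span_le S K : S `<=` K -> ideal_span S `<=` K.
Proof. by move=> SK x; apply. Qed.

(** The ideal w I + J. One shape serves two purposes: with [I] the unit ideal it adjoins the
    generator [w] to [J], and with w = 1 it is the sum of two ideals. *)
Lemma ideal_lin_closed w I J :
  ideal_closed [set x | exists a b, [/\ I a, J b & x = w * a + b]].
Proof.
split=> [|x y [a [b [Ia Jb ->]]] [c [d [Ic Jd ->]]]|r x [a [b [Ia Jb ->]]]].
- by exists 0, 0; split; [exact: ideal0|exact: ideal0|ring].
- by exists (a + c), (b + d); split; [exact: idealD|exact: idealD|ring].
- by exists (r * a), (r * b); split; [exact: idealM|exact: idealM|ring].
Qed.
Definition ideal_lin w I J : ideal A := Ideal (ideal_lin_closed w I J).

Lemma mem_lin_l w I J x : I x -> ideal_lin w I J (w * x).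
Proof. by move=> Ix; exists x, 0; split; rewrite ?addr0 //; apply: ideal0. Qed.

Lemma mem_lin_r w I J x : J x -> ideal_lin w I J x.
Proof. by move=> Jx; exists 0, x; split; rewrite ?mulr0 ?add0r //;
  apply: ideal0. Qed.

Lemma span_nil x : ideal_span [set` ([::] : seq A)] x -> x = 0.
Proof.
have zc : ideal_closed [set 0 : A].
  by split=> [//|_ _ -> ->|a _ ->]; [apply: addr0|apply: mulr0].
by move=> /(_ (Ideal zc)); apply.
Qed.

Lemma span_rcons s w :
  ideal_span [set` rcons s w] =
  ideal_lin w (unit_ideal A) (ideal_span [set` s]).
Proof.
apply: ideal_le_anti => [|x [a [b [_ sb ->]]]].
  apply: ideal_span_le => x xs; have {xs} : x \in rcons s w := xs.
  rewrite mem_rcons inE => /predU1P[->|xs].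
    by rewrite -[X in ideal_set _ X]mulr1; apply: mem_lin_l.
  by apply: mem_lin_r; apply: sub_ideal_span.
apply: idealD; last first.
  move: b sb; apply: ideal_span_le => y ys; apply: sub_ideal_span.
  by rewrite /= mem_rcons inE (ys : y \in s) orbT.
by apply: idealMr; apply: sub_ideal_span; rewrite /= mem_rcons mem_head.
Qed.

Lemma eq_mem_span s t : s =i t -> ideal_span [set` s] = ideal_span [set` t].
Proof.
move=> st; apply: ideal_le_anti; apply: ideal_span_le => x xs;
  by apply: sub_ideal_span; move: xs; rewrite /= st.
Qed.

Lemma sub_mem_span s t :
  {subset s <= t} -> ideal_span [set` s] `<=` ideal_span [set` t].
Proof.
by move=> st; apply: ideal_span_le => x /st xt; apply: sub_ideal_span.
Qed.

Lemma span_middle s w t :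
  ideal_span [set` s ++ w :: t] =
  ideal_lin w (unit_ideal A) (ideal_span [set` s ++ t]).
Proof.
rewrite -span_rcons; apply: eq_mem_span => x.
by rewrite mem_rcons !(inE, mem_cat) orbCA.
Qed.

Lemma mem_span_nth s i : (i < size s)%N -> ideal_span [set` s] s`_i.
Proof. by move=> si; apply: sub_ideal_span; apply: mem_nth. Qed.

Lemma span_sumP s x :
  ideal_span [set` s] x -> exists c : nat -> A, x = \sum_(i < size s) c i * s`_i.
Proof.
elim/last_ind: s x => [|s w IH] x.
  by move/span_nil ->; exists (fun=> 0); rewrite big_ord0.
rewrite span_rcons => -[a [b [_ /IH[c ->] ->]]].
exists (fun i => if (i < size s)%N then c i else a).
rewrite size_rcons big_ord_recr /= ltnn nth_rcons ltnn eqxx addrC mulrC.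
by congr (_ + _); apply: eq_bigr => i _; rewrite nth_rcons ltn_ord.
Qed.

Lemma mem_ideal_mul I J x y : I x -> J y -> ideal_mul I J (x * y).
Proof. by move=> Ix Jy; apply: sub_ideal_span; exists x => //; exists y. Qed.

Lemma ideal_mul_ind I J K :
  (forall x y, I x -> J y -> K (x * y)) -> ideal_mul I J `<=` K.
Proof. by move=> H; apply: ideal_span_le => _ [x Ix [y Jy <-]]; apply: H. Qed.

Lemma ideal_mulS I J K L : I `<=` K -> J `<=` L ->
  ideal_mul I J `<=` ideal_mul K L.
Proof.
move=> IK JL; apply: ideal_mul_ind => x y /IK Kx /JL Ly.
exact: mem_ideal_mul.
Qed.

Lemma ideal_mulC I J : ideal_mul I J = ideal_mul J I.
Proof.
by apply: ideal_le_anti; apply: ideal_mul_ind => x y Ix Jy; rewrite mulrC;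
   apply: mem_ideal_mul.
Qed.

Lemma ideal_mul_lel I J : ideal_mul I J `<=` I.
Proof. by apply: ideal_mul_ind => x y Ix _; apply: idealMr. Qed.

Lemma ideal_mul_ler I J : ideal_mul I J `<=` J.
Proof. by apply: ideal_mul_ind => x y _; apply: idealM. Qed.

Lemma ideal_mul1 I : ideal_mul (unit_ideal A) I = I.
Proof.
apply: ideal_le_anti => [|x Ix]; first exact: ideal_mul_ler.
by rewrite -[x]mul1r; apply: mem_ideal_mul.
Qed.

Lemma ideal_colon1_closed K y : ideal_closed [set x | K (x * y)].
Proof.
split=> [|x x' Kx Kx'|a x Kx] /=; first by rewrite mul0r; apply: ideal0.
- by rewrite mulrDl; apply: idealD.
- by rewrite -mulrA; apply: idealM.
Qed.
Definition ideal_colon1 K y : ideal A := Ideal (ideal_colon1_closed K y).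

Lemma ideal_colon1E K y x : ideal_colon1 K y x = K (x * y).
Proof. by []. Qed.

Lemma ideal_mulA I J K :
  ideal_mul I (ideal_mul J K) = ideal_mul (ideal_mul I J) K.
Proof.
have half I' J' K' : ideal_mul I' (ideal_mul J' K') `<=`
    ideal_mul (ideal_mul I' J') K'.
  apply: ideal_mul_ind => x y I'x; rewrite mulrC.
  suff H : ideal_mul J' K' `<=` ideal_colon1 (ideal_mul (ideal_mul I' J') K') x.
    exact: H.
  apply: ideal_mul_ind => a b J'a K'b ; rewrite ideal_colon1E mulrC mulrA.
  by apply: mem_ideal_mul => //; apply: mem_ideal_mul.
apply: ideal_le_anti; first exact: half.
have := half K J I.
by rewrite (ideal_mulC K) (ideal_mulC J I) (ideal_mulC K J) (ideal_mulC _ I).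
Qed.

Lemma ideal_expE I n : ideal_exp I n.+1 = ideal_mul I (ideal_exp I n).
Proof. by []. Qed.

Lemma ideal_mul_exp0 I J : ideal_mul I (ideal_exp J 0) = I.
Proof. by rewrite ideal_mulC ideal_mul1. Qed.

Lemma ideal_exp1 I : ideal_exp I 1 = I.
Proof. by rewrite /= ideal_mulC ideal_mul1. Qed.

Lemma ideal_expD I i j :
  ideal_mul (ideal_exp I i) (ideal_exp I j) = ideal_exp I (i + j).
Proof.
elim: i => [|i IH]; first exact: ideal_mul1.
by rewrite addSn /= -ideal_mulA IH.
Qed.

Lemma ideal_expS I J n : I `<=` J -> ideal_exp I n `<=` ideal_exp J n.
Proof. by move=> IJ; elim: n => [|n IH] //=; apply: ideal_mulS. Qed.

Lemma mem_ideal_expM I i j x y :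
  ideal_exp I i x -> ideal_exp I j y -> ideal_exp I (i + j) (x * y).
Proof. by move=> Ix Iy; rewrite -ideal_expD; apply: mem_ideal_mul. Qed.

Lemma ideal_exp_le I i j : (i <= j)%N -> ideal_exp I j `<=` ideal_exp I i.
Proof.
by move=> ij; rewrite -(subnKC ij) -ideal_expD; apply: ideal_mul_lel.
Qed.

Lemma ideal_lin_le w I J K :
  (forall x, I x -> K (w * x)) -> J `<=` K -> ideal_lin w I J `<=` K.
Proof.
by move=> IK JK _ [a [b [Ia Jb ->]]]; apply: idealD; [apply: IK|apply: JK].
Qed.

Lemma mul_ideal_lin K w I J :
  ideal_mul K (ideal_lin w I J) `<=` ideal_lin w (ideal_mul K I) (ideal_mul K J).
Proof.
apply: ideal_mul_ind => x _ Kx [a [b [Ia Jb ->]]].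
exists (x * a), (x * b); split; try exact: mem_ideal_mul.
by ring.
Qed.

(** When a product of n+1 factors from (w) + L is expanded, the only terms without a factor [w] lie
    in L^(n+1). This splitting drives the inductions along a regular sequence. *)
Lemma ideal_exp_lin w L n :
  ideal_exp (ideal_lin w (unit_ideal A) L) n.+1 `<=`
  ideal_lin w (ideal_exp (ideal_lin w (unit_ideal A) L) n) (ideal_exp L n.+1).
Proof.
set L' := ideal_lin _ _ _; have LL' : L `<=` L' by move=> x; apply: mem_lin_r.
elim: n => [|n IH].
  rewrite !ideal_exp1 => x [a [b [_ Lb ->]]].
  by exists a, b; split.
apply: ideal_mul_ind => _ y [a [b [_ Lb ->]]] L'y.
rewrite mulrDl -mulrA; apply: idealD.
  by apply: mem_lin_l; apply: idealM.
have [c [d [L'c Ld ->]]] := IH _ L'y; rewrite mulrDr; apply: idealD.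
  rewrite mulrCA; apply: mem_lin_l.
  by apply: mem_ideal_mul => //; apply: LL'.
by apply: mem_lin_r; apply: mem_ideal_mul.
Qed.

Lemma maximal_disjoint I S : (forall x, I x -> S x -> False) ->
  exists M : ideal A, [/\ I `<=` M, forall x, M x -> S x -> False &
    forall K, M `<=` K -> (forall x, K x -> S x -> False) -> K = M].
Proof.
move=> IS; pose p (X : set A) := X = set0 \/
  exists K, [/\ X = K, I `<=` K & forall x, K x -> S x -> False].
have [F FP Ftot|M [MP Mmax]] := @Zorn_bigcup _ p.
  have [[X FX [x Xx]]|F0] := pselect (exists2 X, F X & exists x, X x); last first.
    left; rewrite -subset0 => x [X FX Xx]; apply: F0.
    by exists X => //; exists x.
  have cF : ideal_closed (\bigcup_(X in F) X).
    split=> [|a b [Y FY Ya] [Z FZ Zb]|a b [Y FY Yb]].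
    - exists X => //; case: (FP _ FX) => [X0|[K [-> _ _]]]; last exact: ideal0.
      by move: Xx; rewrite X0.
    - wlog YZ : a b Y Z FY FZ Ya Zb / Y `<=` Z.
        move=> H; case: (Ftot _ _ FY FZ) => h; first exact: (H a b Y Z).
        by rewrite addrC; apply: (H b a Z Y).
      exists Z => //; case: (FP _ FZ) => [Z0|[K [eZ _ _]]].
        by move: Zb; rewrite Z0.
      by move/YZ: Ya Zb; rewrite eZ; apply: idealD.
    exists Y => //; case: (FP _ FY) => [Y0|[K [eY _ _]]].
      by move: Yb; rewrite Y0.
    by move: Yb; rewrite eY; apply: idealM.
  right; exists (Ideal cF); split=> //.
    move=> y Iy; exists X => //; case: (FP _ FX) => [X0|[K [-> IK _]]].
      by move: Xx; rewrite X0.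
    exact: IK.
  move=> y [Y FY Yy]; case: (FP _ FY) => [Y0|[K [eY _ KS]]].
    by move: Yy; rewrite Y0.
  by apply: KS; rewrite -eY.
case: MP => [M0|[K [eM IK KS]]].
  exfalso; apply: (Mmax I); last by right; exists I; split.
  by rewrite M0; split=> // /(_ 0); apply; apply: ideal0.
exists K; split=> // K' KK' K'S; apply: ideal_le_anti => //.
apply: contrapT => K'K; apply: (Mmax K'); last first.
  by right; exists K'; split=> // x /IK/KK'.
by rewrite eM.
Qed.

Definition mult_set S := S 1 /\ forall x y, S x -> S y -> S (x * y).

(** Primes are produced below by choosing what they must avoid: an ideal maximal among those missing
    a multiplicative set is prime. *)
Lemma prime_disjoint I S : mult_set S -> (forall x, I x -> S x -> False) ->
  exists Q, [/\ prime_ideal Q, I `<=` Q & forall x, Q x -> S x -> False].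
Proof.
move=> [S1 SM] /maximal_disjoint[M [IM MS Mmax]]; exists M; split=> //.
split=> [M1|x y Mxy]; first exact: MS M1 S1.
have key w : ~ M w -> exists2 s, S s & ideal_lin w (unit_ideal A) M s.
  move=> Mw; apply: contrapT => H; apply: Mw.
  rewrite -(Mmax (ideal_lin w (unit_ideal A) M)).
  - by rewrite -[X in ideal_set _ X]mulr1; apply: mem_lin_l.
  - by move=> z; apply: mem_lin_r.
  - by move=> s Ms Ss; apply: H; exists s.
apply: contrapT => /not_orP[/key[s Ss [a [b [_ Mb es]]]]].
move=> /key[t St [c [d [_ Md et]]]].
apply: (MS (s * t)); last exact: SM.
have -> : s * t = (a * c) * (x * y) + (y * c + d) * b + (x * a) * d.
  by rewrite es et; ring.
by apply: idealD; [apply: idealD|]; apply: idealM.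
Qed.

Lemma prime_chain_sub n P (i j : nat) : prime_chain n P ->
  (i <= j)%N -> (j <= n)%N -> P i `<=` P j.
Proof.
move=> [_ PS] ij jn; elim: j ij jn => [|j IH].
  by rewrite leqn0 => /eqP-> _ x.
rewrite leq_eqVlt => /predU1P[-> _ x //|ij] jn x Px.
by have [+ _] := PS j jn; apply; apply: IH => //; apply: ltnW.
Qed.

Lemma prime_chain_rcons n P Q : prime_chain n P -> prime_ideal Q ->
  P n `<` Q -> prime_chain n.+1 (fun i => if (i <= n)%N then P i else Q).
Proof.
move=> [Pp PS] Qp PQ; split=> i ilen; first by case: ifP => // /Pp.
case: (ltnP i n) => [lin|nlei]; first by rewrite (ltnW lin); apply: PS.
have -> : i = n by apply/eqP; rewrite eqn_leq nlei -ltnS ilen.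
by rewrite leqnn.
Qed.

Lemma prime_chain_cons n P Q : prime_chain n P -> prime_ideal Q ->
  Q `<` P 0%N -> prime_chain n.+1 (fun i => if i is i'.+1 then P i' else Q).
Proof. by move=> [Pp PS] Qp QP; split=> -[|i] //; [apply: Pp|apply: PS]. Qed.

Lemma ideal_properP I J : I `<` J -> exists2 x, J x & ~ I x.
Proof.
by case=> _ /existsNP[x /not_implyP[Jx nIx]]; exists x.
Qed.

Lemma proper_ideal I J x : I `<=` J -> J x -> ~ I x -> I `<` J.
Proof. by move=> IJ Jx Ix; split=> // /(_ x Jx). Qed.

End Ideals.

(** * Units and Nakayama's lemma in a local ring *)

Section LocalRing.
Variables (A : comPzRingType) (m : ideal A) (hm : local_ring m).
Implicit Types (I J K L : ideal A).

Lemma local_unit u : ~ m u -> exists v, u * v = 1.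
Proof.
move=> mu; have [_ mU] := hm.
apply: contrapT => nv.
have [x|M [uM M1 Mmax]] := @maximal_disjoint A
    (ideal_lin u (unit_ideal A) (ideal_span set0)) [set 1].
  move=> [a [b [_ b0 ->]]] /= e1; apply: nv; exists a; rewrite -{}e1.
  have := b0 (ideal_span [set` ([::] : seq A)]) => /(_ (sub0set _))/span_nil->.
  by rewrite addr0.
apply: mu; rewrite -(mU M).
  by apply: uM; rewrite -[X in ideal_set _ X]mulr1; apply: mem_lin_l.
by split=> [/M1/(_ erefl)|J MJ J1] //; apply: Mmax => // x Jx xE; apply: J1;
  rewrite -xE.
Qed.

Lemma proper_sub_local I : ~ I 1 -> I `<=` m.
Proof.
move=> I1 x Ix; apply: contrapT => /local_unit[v xv].
by apply: I1; rewrite -xv; apply: idealMr.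
Qed.

Lemma maximal_proper : ~ m 1. Proof. by have [[]] := hm. Qed.

(** Elimination of generators: the coefficient [a] of the last generator in its own relation lies in
    [m], so 1 - a is a unit, the generator can be solved for, and substituting it leaves relations
    of the same kind among the others. *)
Lemma nakayama s K :
  (forall i, (i < size s)%N -> exists k l,
     [/\ K k, ideal_mul m (ideal_span [set` s]) l & s`_i = k + l]) ->
  ideal_span [set` s] `<=` K.
Proof.
elim/last_ind: s K => [|s w IH] K H; first by move=> x /span_nil->; apply: ideal0.
have dec i : (i < size (rcons s w))%N -> exists a k l, [/\ m a, K k,
    ideal_mul m (ideal_span [set` s]) l & (rcons s w)`_i = k + a * w + l].
  move=> /H[k [l [Kk + ->]]]; rewrite span_rcons => /mul_ideal_lin.
  move=> [a [b [/ideal_mul_lel ma mb ->]]]; exists a, k, b; split=> //; ring.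
have [|a [k [l [ma Kk ml]]]] := dec (size s); first by rewrite size_rcons.
rewrite nth_rcons ltnn eqxx => ew.
have [|v av] := @local_unit (1 - a).
  move=> m1a; apply: maximal_proper; rewrite -[1](subrK a).
  exact: idealD.
have {}ew : w = v * k + v * l.
  rewrite -[w]mul1r -av mulrAC mulrBl mul1r {1}ew.
  by ring.
have sK : ideal_span [set` s] `<=` K.
  apply: IH => i si; have := dec i; rewrite size_rcons nth_rcons si.
  move=> /(_ (ltnW si))[b [k' [l' [mb Kk' ml' ->]]]].
  exists (k' + b * (v * k)), (b * (v * l) + l'); split; last by rewrite ew; ring.
    by apply: idealD => //; do 2 apply: idealM.
  by apply: idealD => //; do 2 apply: idealM.
rewrite span_rcons; apply: ideal_lin_le => // x _; apply: idealMr.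
by rewrite ew; apply: idealD; apply: idealM => //; apply: sK;
  apply: ideal_mul_ler ml.
Qed.

End LocalRing.

(** * Regular sequences *)

Section RegularSequences.
Variable A : comPzRingType.
Implicit Types (I J K L : ideal A) (s t : seq A).

Definition weakly_regular s : Prop := forall i x, (i < size s)%N ->
  ideal_span [set` take i s] (s`_i * x) -> ideal_span [set` take i s] x.

Lemma weakly_regular_rcons s w : weakly_regular (rcons s w) ->
  weakly_regular s /\
  forall x, ideal_span [set` s] (w * x) -> ideal_span [set` s] x.
Proof.
rewrite -cats1 => H; split=> [i x si|x].
  have := H i x; rewrite take_cat si nth_cat si; apply.
  by rewrite size_cat addn1 ltnW.
have := H (size s) x; rewrite take_size_cat // nth_cat ltnn subnn /=.
by apply; rewrite size_cat addn1.
Qed.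

(* The two non-zero-divisor conditions on a regular pair [a, b] modulo [M]
   imply that [a] is regular modulo [M + (b)]. *)
Lemma weakly_regular_skip s a t v : weakly_regular (s ++ a :: t) ->
  ideal_span [set` s ++ t] (a * v) -> ideal_span [set` s ++ t] v.
Proof.
elim/last_ind: t v => [|t b IH] v.
  by rewrite cats0 cats1 => /weakly_regular_rcons[_]; apply.
rewrite -rcons_cons -!rcons_cat => /weakly_regular_rcons[reg].
have := IH _ reg; rewrite !span_rcons span_middle => aM bM.
move=> [x [y [_ My e]]].
have [|x' [y' [_ My' ex]]] := bM x.
  exists v, (- y); split=> //; first exact: idealN.
  by rewrite e; ring.
exists x', (v - b * x'); split=> //; last by ring.
apply: aM; have -> : a * (v - b * x') = b * y' + y.
  by rewrite mulrBr e ex; ring.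
by apply: idealD => //; apply: idealM.
Qed.

Lemma span_sum_others s (c : nat -> A) i : (i < size s)%N ->
  exists2 l, ideal_span [set` take i s ++ drop i.+1 s] l &
    \sum_(j < size s) c j * s`_j = c i * s`_i + l.
Proof.
move=> si; rewrite (bigD1 (Ordinal si)) //.
exists (\sum_(j < size s | j != Ordinal si) c j * s`_j) => //.
apply: ideal_sum => j ji; apply: idealM.
apply: sub_ideal_span; rewrite /= mem_cat.
have [ltji|leij] := ltnP j i.
  by rewrite -(nth_take 0 ltji) mem_nth // size_take si.
have ltij : (i < j)%N.
  by rewrite ltn_neqAle leij andbT; apply: contra ji => /eqP eij;
    apply/eqP/val_inj.
rewrite -(subnKC ltij) -nth_drop mem_nth ?orbT //.
by rewrite size_drop ltn_sub2r // (leq_ltn_trans ltij).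
Qed.

(** Each entry is a non-zero-divisor modulo all the other entries together, by
    [weakly_regular_skip]; this replaces an argument with Koszul relations. *)
Lemma weakly_regular_relation s (c : nat -> A) i : weakly_regular s ->
  \sum_(j < size s) c j * s`_j = 0 -> (i < size s)%N ->
  ideal_span [set` s] (c i).
Proof.
move=> reg + si; have [l Ll ->] := span_sum_others c si => c0.
have es : s = take i s ++ s`_i :: drop i.+1 s.
  by rewrite -drop_nth // cat_take_drop.
apply: (@sub_mem_span _ (take i s ++ drop i.+1 s)).
  move=> x; rewrite [in X in _ -> X]es !(mem_cat, inE).
  by case/orP=> ->; rewrite ?orbT.
apply: (@weakly_regular_skip _ s`_i); first by rewrite -es.
by rewrite mulrC -[_ * _](addrK l) c0 sub0r; apply: idealN.
Qed.

(* [(s)^r / b (s)^r] behaves as a free [A/b]-module. *)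
Definition powers_free s := forall (b : ideal A) v, ideal_span [set` s] `<=` b ->
  (forall x, b (v * x) -> b x) ->
  forall r x, ideal_exp (ideal_span [set` s]) r x ->
    ideal_mul b (ideal_exp (ideal_span [set` s]) r) (v * x) ->
    ideal_mul b (ideal_exp (ideal_span [set` s]) r) x.

(** [powers_free] with b = (s) says that an element regular modulo (s) is regular on every layer
    (s)^n / (s)^(n+1); climbing the layers makes [w] regular modulo all powers of (s). *)
Lemma powers_free_nzd s w : powers_free s -> weakly_regular (rcons s w) ->
  forall n x, ideal_exp (ideal_span [set` s]) n (w * x) ->
    ideal_exp (ideal_span [set` s]) n x.
Proof.
move=> S /weakly_regular_rcons[_ reg]; elim=> [//|n IH] x sx.
apply: (S _ w) => //; apply: IH; apply: ideal_exp_le sx; exact: leqnSn.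
Qed.

(** Rees's theorem that a regular sequence is quasi-regular, stated without the associated graded
    ring. The induction runs over the sequence and, for a fixed last entry [w], over the
    exponent. *)
Lemma weakly_regular_powers_free s : weakly_regular s -> powers_free s.
Proof.
elim/last_ind: s => [|s w IH] reg b v sb bv.
  elim=> [|r _] x; first by rewrite !ideal_mul_exp0 => _; apply: bv.
  by move/ideal_mul_lel/span_nil=> -> _; apply: ideal0.
have [/IH S _] := weakly_regular_rcons reg.
have P := powers_free_nzd S reg.
have sL : ideal_span [set` s] `<=` ideal_span [set` rcons s w].
  by rewrite span_rcons => x; apply: mem_lin_r.
have wL : ideal_span [set` rcons s w] w.
  by apply: sub_ideal_span; rewrite /= mem_rcons mem_head.
elim=> [|r IHr] x; first by rewrite !ideal_mul_exp0 => _; apply: bv.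
have dec := @ideal_exp_lin _ w (ideal_span [set` s]) r.
rewrite -span_rcons in dec.
move=> /dec[x1 [x2 [Lx1 sx2 ->]]].
move=> /(ideal_mulS (K := b) (fun _ => id) dec)/mul_ideal_lin.
move=> [b1 [b2 [bb1 bb2 e]]].
have eb2 : b2 = v * (w * x1 + x2) - w * b1 by rewrite e addrC addKr.
(* Both x and v x are split as w (...) + (...). Since [w] is regular modulo powers of (s), the two
   coefficients of [w] agree up to (s)^(r+1), so [x1] and [x2] can be treated separately. *)
have st : ideal_exp (ideal_span [set` s]) r.+1 (v * x1 - b1).
  apply: P; have -> : w * (v * x1 - b1) = b2 - v * x2.
    by rewrite eb2; ring.
  by apply: idealB; [apply: ideal_mul_ler bb2|apply: idealM].
have bx1 : ideal_mul b (ideal_exp (ideal_span [set` rcons s w]) r) x1.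
  apply: IHr => //; rewrite -[v * x1](subrK b1); apply: idealD => //.
  by apply: ideal_mulS st => // [y /sL/sb //|]; apply: ideal_expS.
have bx2 : ideal_mul b (ideal_exp (ideal_span [set` s]) r.+1) x2.
  apply: (S _ v) => //; first by move=> y /sL/sb.
  have -> : v * x2 = b2 - w * (v * x1 - b1).
    by rewrite eb2; ring.
  by apply: idealB => //; apply: mem_ideal_mul => //; apply: sb.
apply: idealD; last by apply: ideal_mulS bx2 => //;
  apply: (ideal_expS (n := r.+1)).
by rewrite ideal_mulA (ideal_mulC b) -ideal_mulA; apply: mem_ideal_mul.
Qed.

Section Last.
Variables (s : seq A) (w : A) (c : ideal A).
Hypotheses (reg : weakly_regular (rcons s w)) (wc : c w).
Let L := ideal_span [set` s].
Let L' := ideal_span [set` rcons s w].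

Lemma weakly_regular_nzd_exp n x : ideal_exp L n (w * x) -> ideal_exp L n x.
Proof.
apply: powers_free_nzd => //; apply: weakly_regular_powers_free.
by have [] := weakly_regular_rcons reg.
Qed.

Let split_exp n :
  ideal_mul c (ideal_exp L' n.+1) `<=`
  ideal_lin w (ideal_mul c (ideal_exp L' n)) (ideal_mul c (ideal_exp L n.+1)).
Proof.
move=> x cx; apply: mul_ideal_lin; apply: ideal_mulS cx => // y.
by rewrite /L' span_rcons; apply: ideal_exp_lin.
Qed.

(** Degree by degree, wt is a non-zero-divisor on R[L't] / c R[L't]. *)
Lemma weakly_regular_nzd_mul n x : L `<=` c ->
  ideal_mul c (ideal_exp L' n.+1) (w * x) -> ideal_mul c (ideal_exp L' n) x.
Proof.
move=> Lc /split_exp[u [v [cu cv e]]]; rewrite -[x](subrK u); apply: idealD => //.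
have : ideal_exp L n.+1 (x - u).
  apply: weakly_regular_nzd_exp; rewrite mulrBr e addrC addKr.
  exact: ideal_mul_ler cv.
apply: ideal_mulS => //; apply: ideal_expS => y Ly.
by rewrite /L' span_rcons; apply: mem_lin_r.
Qed.

(** Degree by degree, R[Lt] / c R[Lt] embeds into R[L't] / (c, wt): killing wt loses nothing that
    was already expressed without [w]. *)
Lemma weakly_regular_contract n x v u : ideal_exp L n x -> x = w * v + u ->
  ideal_mul c (ideal_exp L' n) u -> ideal_mul c (ideal_exp L n) x.
Proof.
case: n => [_ ->|n Lx e /split_exp[a [b [ca cb eu]]]].
  rewrite !ideal_mul_exp0 => cu.
  by apply: idealD => //; apply: idealMr.
have -> : x = w * (v + a) + b by rewrite e eu; ring.
apply: idealD => //; apply: mem_ideal_mul => //.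
apply: weakly_regular_nzd_exp; have -> : w * (v + a) = x - b.
  by rewrite e eu; ring.
by apply: idealB => //; apply: ideal_mul_ler cb.
Qed.

End Last.

(** The primes are found from the top. As [w] is regular modulo (s) and (s) lies in [Q], no product
    a w^n with [a] outside [Q] is in (s); a prime over (s) avoiding these products lies in [Q] and
    omits [w]. *)
Lemma prime_chain_above_regular s (Q : ideal A) : weakly_regular s ->
  prime_ideal Q -> ideal_span [set` s] `<=` Q ->
  exists2 P, prime_chain (size s) P & P (size s) = Q.
Proof.
elim/last_ind: s Q => [|s w IH] Q reg Qp sQ.
  by exists (fun=> Q) => //; split=> -[].
have [/IH{}IH wreg] := weakly_regular_rcons reg.
have wQ : Q w by apply: sQ; apply: sub_ideal_span; rewrite /= mem_rcons mem_head.
have ssQ : ideal_span [set` s] `<=` Q.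
  by move=> x sx; apply: sQ; rewrite span_rcons; apply: mem_lin_r.
pose S := [set x : A | exists a n, ~ Q a /\ x = a * w ^+ n].
have [||P0 [P0p sP0 P0S]] := @prime_disjoint _ (ideal_span [set` s]) S.
- split=> [|_ _ [a [i [Qa ->]]] [b [j [Qb ->]]]].
    by exists 1, 0%N; split; [case: Qp|rewrite expr0 mulr1].
  exists (a * b), (i + j)%N; split; last by rewrite exprD; ring.
  by move=> /Qp.2[].
- move=> x sx [a [n [Qa e]]]; move: sx; rewrite {}e; elim: n => [|n IHn].
    by rewrite expr0 mulr1 => /ssQ.
  by rewrite exprS mulrCA => /wreg.
have P0Q : P0 `<=` Q.
  move=> x P0x; apply: contrapT => Qx; apply: (P0S x) => //.
  by exists x, 0%N; rewrite expr0 mulr1.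
have [P Pc PP0] := IH P0 P0p sP0; rewrite size_rcons.
exists (fun i => if (i <= size s)%N then P i else Q); last by rewrite ltnn.
apply: prime_chain_rcons => //; rewrite PP0; apply: (proper_ideal (x := w)) => //.
move=> P0w; apply: (P0S w) => //; exists 1, 1%N.
by rewrite expr1 mul1r; split=> //; case: Qp.
Qed.

End RegularSequences.

(** * Localization at a prime *)

Section LocalizationAtPrime.
Variables (A : comPzRingType) (p : ideal A) (hp : prime_ideal p).
Local Notation Ap := (localization hp).
Implicit Types (I J : ideal A) (f : fraction hp).

Definition loc_of (a : A) : Ap := to_loc (mk_frac hp a hp.1).

Lemma loc_ofD a b : loc_of (a + b) = loc_of a + loc_of b.
Proof.
by rewrite /loc_of [RHS]to_locD; apply: to_loc_ext; do 3 rewrite /frac_den /=;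
  ring.
Qed.

Lemma loc_ofM a b : loc_of (a * b) = loc_of a * loc_of b.
Proof.
by rewrite /loc_of [RHS]to_locM; apply: to_loc_ext; do 3 rewrite /frac_den /=;
  ring.
Qed.

Lemma loc_of_unit s : ~ p s -> exists v, loc_of s * v = 1.
Proof.
move=> ps; exists (to_loc (mk_frac hp 1 ps)).
by rewrite /loc_of [LHS]to_locM; apply: to_loc_ext; do 3 rewrite /frac_den /=;
  ring.
Qed.

Lemma loc_of_den f : to_loc f * loc_of (frac_den f) = loc_of f.1.
Proof.
by rewrite /loc_of [LHS]to_locM; apply: to_loc_ext; do 3 rewrite /frac_den /=;
  ring.
Qed.

Lemma loc_contr_closed (Q : ideal Ap) : ideal_closed [set a | Q (loc_of a)].
Proof.
split=> [|a b Qa Qb|a x Qx] /=; first exact: ideal0.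
- by rewrite loc_ofD; apply: idealD.
- by rewrite loc_ofM; apply: idealM.
Qed.
Definition loc_contr (Q : ideal Ap) : ideal A := Ideal (loc_contr_closed Q).

Lemma loc_contrP (Q : ideal Ap) f : Q (to_loc f) <-> loc_contr Q f.1.
Proof.
rewrite /loc_contr /= -loc_of_den; split=> [|H]; first exact: idealMr.
have [v vE] := loc_of_unit (@frac_denN _ _ _ f).
by rewrite -[X in ideal_set _ X]mulr1 -vE mulrA; apply: idealMr.
Qed.

(** For a prime inside [p], factors outside [p] can be cancelled, so membership depends on the
    numerator alone and not on the representative chosen by [repr]. *)
Lemma loc_ext_repr I f : prime_ideal I -> I `<=` p ->
  I (repr (to_loc f)).1 <-> I f.1.
Proof.
move=> [_ IM] Ip; have [u pu e] := to_loc_repr f.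
have strip a s : ~ p s -> I (u * (a * s)) -> I a.
  by move=> ps /IM[/Ip //|/IM[//|/Ip]].
split=> Ia.
- by apply: (@strip _ _ (@frac_denN _ _ _ (repr (to_loc f)))); rewrite -e;
  apply/idealM/idealMr.
- by apply: (@strip _ _ (@frac_denN _ _ _ f)); rewrite e; apply/idealM/idealMr.
Qed.

Lemma loc_ext_closed I : prime_ideal I -> I `<=` p ->
  ideal_closed [set x : Ap | I (repr x).1].
Proof.
move=> Ipr Ip; split=> [|x y Ix Iy|a x Ix] /=.
- by apply/(loc_ext_repr _ Ipr Ip); apply: ideal0.
- rewrite -[x + y]/(to_loc (frac_add (repr x) (repr y))).
  by apply/(loc_ext_repr _ Ipr Ip); apply: idealD; apply: idealMr.
- rewrite -[a * x]/(to_loc (frac_mul (repr a) (repr x))).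
  by apply/(loc_ext_repr _ Ipr Ip); apply: idealM.
Qed.
Definition loc_ext I (Ipr : prime_ideal I) (Ip : I `<=` p) : ideal Ap :=
  Ideal (loc_ext_closed Ipr Ip).

Lemma loc_extP I (Ipr : prime_ideal I) (Ip : I `<=` p) f :
  loc_ext Ipr Ip (to_loc f) <-> I f.1.
Proof. exact: loc_ext_repr. Qed.

Lemma prime_loc_ext I (Ipr : prime_ideal I) (Ip : I `<=` p) :
  prime_ideal (loc_ext Ipr Ip).
Proof.
split; first by move/loc_extP; case: Ipr.
move=> x y; rewrite -[x]to_locK -[y]to_locK [_ * _]to_locM.
by move=> /loc_extP/Ipr.2[]; [left|right]; apply/loc_extP.
Qed.

Lemma prime_loc_contr (Q : ideal Ap) : prime_ideal Q -> prime_ideal (loc_contr Q).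
Proof.
by move=> [Q1 QM]; split=> // x y; rewrite /loc_contr /= loc_ofM => /QM.
Qed.

Lemma loc_contr_sub (Q : ideal Ap) : ~ Q 1 -> loc_contr Q `<=` p.
Proof.
move=> Q1 a Qa; apply: contrapT => /loc_of_unit[v av].
by apply: Q1; rewrite -av; apply: idealMr.
Qed.

Let pp : p `<=` p. Proof. by []. Qed.
Definition loc_max : ideal Ap := loc_ext hp pp.

Lemma loc_proper_sub (Q : ideal Ap) : ~ Q 1 -> Q `<=` loc_max.
Proof.
move=> /loc_contr_sub Qp x; rewrite -[x]to_locK.
by move=> /loc_contrP/Qp ?; apply/loc_extP.
Qed.

Lemma loc_local : local_ring loc_max.
Proof.
have [m1 _] := prime_loc_ext hp pp; split.
  by split=> // J mJ J1; apply: ideal_le_anti => //; apply: loc_proper_sub.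
by move=> n [n1 nmax]; apply/esym/nmax => //; apply: loc_proper_sub.
Qed.

Lemma loc_of_span s a : ideal_span [set` s] a ->
  ideal_span [set` map loc_of s] (loc_of a).
Proof.
move=> /(_ (loc_contr (ideal_span [set` map loc_of s]))); apply.
by move=> x xs; apply: sub_ideal_span; apply: map_f.
Qed.

Lemma noetherian_loc : noetherian A -> noetherian Ap.
Proof.
move=> hA Q; have [s es] := hA (loc_contr Q); exists (map loc_of s).
apply: ideal_le_anti => [x|]; last first.
  apply: ideal_span_le => _ /mapP[a sa ->].
  by have : loc_contr Q a by rewrite es; apply: sub_ideal_span.
rewrite -[x]to_locK => /loc_contrP; rewrite es => ?.
by apply/loc_contrP/loc_of_span.
Qed.

Lemma krull_dim_loc n : prime_height p n -> krull_dim Ap n.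
Proof.
move=> [[P [Pp PS] Pn] nmax]; split.
  have Psub i : (i <= n)%N -> P i `<=` p.
    by move=> ilen; rewrite -Pn; apply: (prime_chain_sub (n := n)).
  (* [loc_ext] needs proofs that exist only for indices up to [n]; the unit ideal is a filler
     beyond. *)
  pose Q i := if pselect (i <= n)%N is left h then loc_ext (Pp i h) (Psub i h)
              else unit_ideal Ap.
  exists Q; split=> i ilen; rewrite /Q.
    by case: pselect => // h; apply: prime_loc_ext.
  case: pselect => [h|]; last by rewrite (ltnW ilen).
  case: pselect => // h'; have [sub _] := PS i ilen.
  have [a Pa nPa] := ideal_properP (PS i ilen).
  apply: (proper_ideal (x := loc_of a)).
  - by move=> x; rewrite -[x]to_locK => /loc_extP ?; apply/loc_extP/sub.
  - exact/loc_extP.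
  - by move/loc_extP.
move=> k Q [Qp QS].
have Pc : prime_chain k (fun i => loc_contr (Q i)).
  split=> i ik; first by apply/prime_loc_contr/Qp.
  have [sub _] := QS i ik; have [x Qx nQx] := ideal_properP (QS i ik).
  rewrite -[x]to_locK in Qx nQx.
  apply: (proper_ideal (x := (repr x).1)); first by move=> a; apply: sub.
    by move: Qx => /loc_contrP.
  by move=> h; apply: nQx; apply/loc_contrP.
have Qkp : loc_contr (Q k) `<=` p by apply: loc_contr_sub; case: (Qp k (leqnn k)).
(* A contracted chain may stop short of [p]; appending [p] then gives an even better bound. *)
have [e|ne] := pselect (loc_contr (Q k) = p); first exact: nmax Pc e.
apply: ltnW; apply: nmax (prime_chain_rcons Pc hp _) _; last by rewrite ltnn.
by split=> // pQ; apply: ne; apply: ideal_le_anti.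
Qed.

Lemma regular_localization s : noetherian A -> prime_height p (size s) ->
  (forall x, x \in s -> p x) ->
  (forall u, p u -> exists2 b, ~ p b & ideal_span [set` s] (b * u)) ->
  regular_local_ring Ap.
Proof.
move=> hA hs sp gen; split; first exact: noetherian_loc.
exists loc_max; split; first exact: loc_local.
exists (map loc_of s); last by rewrite size_map; apply: krull_dim_loc.
apply: ideal_le_anti => [x|]; last first.
  apply: ideal_span_le => _ /mapP[a /sp pa ->].
  exact/loc_extP.
rewrite -[x]to_locK => /loc_extP/gen[b pb sb].
apply/loc_contrP; have [v bv] := loc_of_unit pb.
have := loc_of_span sb; rewrite loc_ofM => /(idealM v).
by rewrite mulrA (mulrC v) bv mul1r.
Qed.

End LocalizationAtPrime.

(** * Links of primes *)

Section LinkOfPrime.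
Variables (A : comPzRingType) (hA : noetherian A) (p : ideal A).
Variables (hp : prime_ideal p) (z : seq A).
Hypothesis hg : prime_height p (size z).
Hypothesis hz : weakly_regular z.
Hypothesis hzp : [set` z] `<=` p.
Let J := ideal_span [set` z].
Let I := ideal_colon J p.

Let Jp : J `<=` p. Proof. exact: ideal_span_le. Qed.

Lemma span_sub_link : J `<=` I.
Proof. by move=> x Jx y _; apply: idealMr. Qed.

(** The ring (A/J)_p has a nonzero socle because [p] is minimal over [J]. A socle element comes from
    1 by treating the generators of [p] one at a time, each time multiplying by the last power that
    does not vanish. *)
Lemma link_neq_span : I <> J.
Proof.
(* [E e] expresses that the class of [e] in (A/J)_p is nonzero. *)
pose E e := forall s, ~ p s -> ~ J (s * e).
(* Otherwise a prime over [J] inside [p] omits [u]; it already carries a chain of length g, and [p]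
   on top makes that chain too long. *)
have cut u : p u -> exists n s, ~ p s /\ J (s * u ^+ n).
  move=> pu; apply: contrapT => H.
  pose S := [set x : A | exists a n, ~ p a /\ x = a * u ^+ n].
  have [||Q [Qp JQ QS]] := @prime_disjoint _ J S.
  - split=> [|_ _ [a [i [pa ->]]] [b [j [pb ->]]]].
      by exists 1, 0%N; split; [case: hp|rewrite expr0 mulr1].
    exists (a * b), (i + j)%N; split; last by rewrite exprD; ring.
    by move=> /hp.2[].
  - by move=> x Jx [a [n [pa e]]]; apply: H; exists n, a; rewrite -e.
  have [P Pc PQ] := prime_chain_above_regular hz Qp JQ.
  have : ((size z).+1 <= size z)%N; last by rewrite ltnn.
  apply: hg.2 (prime_chain_rcons Pc hp _) _; last by rewrite ltnn.
  rewrite PQ; apply: (proper_ideal (x := u)) => //.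
    move=> x Qx; apply: contrapT => px; apply: (QS x) => //.
    by exists x, 0%N; rewrite expr0 mulr1.
  move=> Qu; apply: (QS u) => //; exists 1, 1%N.
  by rewrite mul1r expr1; split=> //; case: hp.
have step u e : p u -> E e -> exists a, E (a * e) /\ J (u * (a * e)).
  move=> /cut[n0 [s0 [ps0 Js0]]] Ee.
  pose b n := `[< exists s, ~ p s /\ J (s * u ^+ n * e) >].
  have [|[|n] /asboolP[s [ps Js]] nmin] := @ex_minnP b.
  - by exists n0; apply/asboolP; exists s0; split=> //; apply: idealMr.
  - by case: (Ee s ps); move: Js; rewrite expr0 mulr1.
  exists (s * u ^+ n); split; last by rewrite exprS in Js; move: Js;
    congr (ideal_set J _); ring.
  move=> t pt Jt; have : (n.+1 <= n)%N; last by rewrite ltnn.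
  apply: nmin; apply/asboolP; exists (t * s); split; first by move=> /hp.2[].
  by move: Jt; congr (ideal_set J _); ring.
have [us eus] := hA p.
have [e Ee Je] : exists2 e, E e & forall u, u \in us -> J (u * e).
  have : {subset us <= us} by [].
  elim: {1 3}us => [|u vs IH] sub.
    by exists 1 => // s ps; rewrite mulr1 => /Jp.
  have [|e Ee Je] := IH; first by move=> x xv; apply: sub; rewrite inE xv orbT.
  have [|a [Ea Ja]] := @step u e _ Ee.
    by rewrite eus; apply: sub_ideal_span; apply: sub; apply: mem_head.
  exists (a * e) => // x; rewrite inE => /predU1P[-> //|/Je].
  by rewrite mulrCA; apply: idealM.
move=> IJ; apply: (Ee 1); first by case: hp.
rewrite mul1r -IJ => y; rewrite eus mulrC.
suff : ideal_span [set` us] `<=` ideal_colon1 J e by apply.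
exact: ideal_span_le.
Qed.

Lemma height_link : I `<=` p -> height I (size z).
Proof.
move=> Ip; split; first by exists p.
move=> Q k Qp IQ [_ kmax].
have JQ : J `<=` Q by move=> x /span_sub_link/IQ.
have [P Pc PQ] := prime_chain_above_regular hz Qp JQ.
exact: kmax Pc PQ.
Qed.

Hypothesis hnreg : ~ regular_local_ring (localization hp).

(** An element of [I] outside [p] becomes a unit at [p] while it multiplies [p] into [J]; then the g
    elements of [z] generate the maximal ideal of the localization. *)
Lemma link_sub_prime : I `<=` p.
Proof.
move=> x Ix; apply: contrapT => px; apply: hnreg.
apply: (@regular_localization _ _ hp z) => // u pu.
by exists x => //; apply: Ix.
Qed.

(* Otherwise, at [p], [c] could replace [z_i] and generate [p] together with
   the remaining [z_j]. *)
Lemma link_coef c x (b : nat -> A) i : p c -> I x ->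
  c * x = \sum_(j < size z) b j * z`_j -> (i < size z)%N -> p (b i).
Proof.
move=> pc Ix + si; have [l + ->] := span_sum_others b si.
set t := _ ++ _ => Ll ecx; apply: contrapT => pb; apply: hnreg.
have ez : z = take i z ++ z`_i :: drop i.+1 z.
  by rewrite -drop_nth // cat_take_drop.
have st : size (c :: t) = size z by rewrite [in RHS]ez /= !size_cat /= addnS.
apply: (@regular_localization _ _ hp (c :: t)) => //; first by rewrite st.
  move=> y; rewrite inE => /predU1P[-> //|yt]; apply: hzp.
  rewrite /= ez mem_cat inE; move: yt; rewrite mem_cat.
  by case/orP=> ->; rewrite ?orbT.
(* One factor [b i] serves to eliminate z_i between the expressions of x u and c x. The other turns
   z_i (b i) into c x - l, after which z_i is cancelled modulo the remaining entries. *)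
move=> u pu; exists (b i * b i); first by move=> /hp.2[].
rewrite -[c :: t]cat0s span_middle cat0s.
have := Ix u pu; rewrite /J ez span_middle => -[a [l' [_ Ll' exu]]].
exists (b i * a), (b i * (b i * u - a * c)); split=> //; last by ring.
apply: (@weakly_regular_skip _ _ z`_i); first by rewrite -ez.
have -> : z`_i * (b i * (b i * u - a * c)) =
    c * (b i * l' - a * l) - l * (b i * u - a * c).
  have -> : b i * l' - a * l = b i * (x * u) - a * (c * x).
    by rewrite exu ecx; ring.
  have -> : l = c * x - b i * z`_i by rewrite ecx addrC addKr.
  by ring.
by apply: idealB; [apply/idealM/idealB; apply: idealM|apply: idealMr].
Qed.

Lemma link_square : ideal_exp I 2 = ideal_mul J (ideal_exp I 1).
Proof.
rewrite ideal_expE ideal_exp1; apply: ideal_le_anti; last first.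
  by apply: ideal_mulS => //; apply: span_sub_link.
apply: ideal_mul_ind => x y Ix Iy.
(* Since [I] lies in [p], the product of two elements of the link is already in [J]; only the
   position of the coefficients is at stake. *)
have [a ea] := span_sumP (Ix y (link_sub_prime Iy)).
rewrite ea; apply: ideal_sum => i _; rewrite mulrC.
apply: mem_ideal_mul; first exact: mem_span_nth.
move=> c pc; have := Ix c pc; rewrite mulrC => /span_sumP[b eb].
have pb := link_coef pc Ix eb (ltn_ord i).
rewrite -[a i * c](subrK (b i * y)); apply: idealD; last first.
  by rewrite mulrC; apply: Iy.
apply: (@weakly_regular_relation _ _ (fun j => a j * c - b j * y)) => //.
under eq_bigr => j _ do rewrite mulrBl -mulrA (mulrC c) mulrA (mulrAC (b j)).
by rewrite sumrB -!mulr_suml -ea -eb; ring.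
Qed.

End LinkOfPrime.

(** * The Rees algebra and going up *)

Section DeterminantTrick.
Variables (B : comNzRingType) (Q : ideal B) (S a : set B).
Hypothesis S1 : S 1.
Hypothesis SB : forall x y, S x -> S y -> S (x - y).
Hypothesis SM : forall x y, S x -> S y -> S (x * y).
Hypothesis aS : a `<=` S.
Hypothesis a0 : a 0.
Hypothesis aD : forall x y, a x -> a y -> a (x + y).
Hypothesis aM : forall x y, S x -> a y -> a (x * y).

(** [S] plays a subring of [B] and [a] an ideal of [S]. By Cramer's rule the determinant of sg Id -
    p kills every [e i] modulo [Q], hence kills 1, which is a combination of them; expanded, it is
    sg^k up to [a]. *)
Lemma determinant_trick k (e c : 'I_k -> B) sg : S sg ->
  Q (1 - \sum_i c i * e i) ->
  (forall i, exists p : 'I_k -> B, (forall j, a (p j)) /\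
     Q (sg * e i - \sum_j p j * e j)) ->
  exists2 al, a al & Q (sg ^+ k - al).
Proof.
move=> Ssg Q1 /choice[p pE].
have S0 : S 0 by rewrite -(subrr 1); apply: SB.
have SN x : S x -> S (- x) by rewrite -sub0r; apply: SB.
have SD x y : S x -> S y -> S (x + y).
  by move=> Sx Sy; rewrite -[y]opprK; apply: SB => //; apply: SN.
have aN x : a x -> a (- x).
  by move=> ax; rewrite -mulN1r; apply: aM => //; apply: SN.
pose M := \matrix_(i, j) (sg *+ (i == j) - p i j).
have Qdet : Q (\det M).
  have Qe i : Q (\det M * e i).
    have -> : \det M * e i = (\adj M *m M *m \col_j e j) i ord0.
      by rewrite mul_adj_mx mul_scalar_mx !mxE.
    rewrite -mulmxA mxE; apply: ideal_sum => j _; apply: idealM.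
    have [_] := pE j; congr (ideal_set Q _); rewrite mxE.
    under [RHS]eq_bigr => l _ do rewrite !mxE mulrBl.
    rewrite sumrB; congr (_ - _).
    rewrite (bigD1 j) //= eqxx mulr1n big1 ?addr0 // => l lj.
    by rewrite eq_sym (negPf lj) mul0r.
  rewrite -[\det M]mulr1 -[X in _ * X](subrK (\sum_i c i * e i)) mulrDr.
  apply: idealD; first exact: idealM.
  by rewrite mulr_sumr; apply: ideal_sum => i _; rewrite mulrCA; apply: idealM.
(* Congruence modulo [a] within [S] respects sums and products, so the two determinants are compared
   term by term in the Leibniz expansion. *)
pose rel x y := [/\ S x, S y & a (x - y)].
have relE : rel (\det M) (\det (sg%:M : 'M_k)).
  apply: (big_ind2 rel); first by split=> //; rewrite subrr.
    move=> x1 x2 y1 y2 [Sx1 Sx2 ax] [Sy1 Sy2 ay]; split; try exact: SD.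
    by rewrite opprD addrACA; apply: aD.
  move=> s _.
  have rM x1 x2 y1 y2 : rel x1 x2 -> rel y1 y2 -> rel (x1 * y1) (x2 * y2).
    move=> [Sx1 Sx2 ax] [Sy1 Sy2 ay]; split; try exact: SM.
    have -> : x1 * y1 - x2 * y2 = x1 * (y1 - y2) + y2 * (x1 - x2) by ring.
    by apply: aD; apply: aM.
  have r1 : rel 1 1 by split=> //; rewrite subrr.
  apply: (rM).
    case: (perm.odd_perm s); last by rewrite expr0.
    by rewrite expr1; split; rewrite ?subrr //; apply: SN.
  apply: (big_ind2 rel) => // i _; rewrite !mxE.
  have [ap _] := pE i; have Ssgn (b : bool) : S (sg *+ b) by case: b;
    rewrite ?mulr0n.
  split=> //; first by apply: SB => //; apply: aS.
  by rewrite addrAC subrr sub0r; apply: aN.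
case: relE => _ _; rewrite det_scalar => /aN; rewrite opprB => al.
by exists (sg ^+ k - \det M) => //; rewrite opprB addrCA subrr addr0.
Qed.

End DeterminantTrick.

(** * Rees algebras described by coefficients, and going up *)

Section ReesAlgebra.
Variables (R : comNzRingType) (I : ideal R).
Local Notation B := (rees_algebra I).
Implicit Types (f g : B) (c J K L : ideal R) (s t : seq R).

Lemma rees_coef f n : ideal_exp I n (rees_val f)`_n.
Proof. by case: f => f /= /asboolP. Qed.

Lemma rees_val_inj f g : rees_val f = rees_val g -> f = g.
Proof. exact: val_inj. Qed.

Lemma rees_ext f g : (forall n, (rees_val f)`_n = (rees_val g)`_n) -> f = g.
Proof. by move=> fg; apply: rees_val_inj; apply/polyP. Qed.

Definition rees_of (q : {poly R}) : B := insubd 0 q.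

Lemma rees_ofK (q : {poly R}) :
  (forall n, ideal_exp I n q`_n) -> rees_val (rees_of q) = q.
Proof. by move=> Iq; apply: insubdK; apply/asboolP. Qed.

Lemma rees_valD f g : rees_val (f + g) = rees_val f + rees_val g.
Proof. exact: (raddfD (\val : B -> _)). Qed.
Lemma rees_valB f g : rees_val (f - g) = rees_val f - rees_val g.
Proof. exact: (raddfB (\val : B -> _)). Qed.
Lemma rees_valM f g : rees_val (f * g) = rees_val f * rees_val g.
Proof. exact: (rmorphM (\val : B -> _)). Qed.
Lemma rees_val0 : rees_val (0 : B) = 0.
Proof. exact: (raddf0 (\val : B -> _)). Qed.
Lemma rees_val1 : rees_val (1 : B) = 1.
Proof. exact: (rmorph1 (\val : B -> _)). Qed.
Lemma rees_val_sum (T : Type) (r : seq T) (P : pred T) (F : T -> B) :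
  rees_val (\sum_(i <- r | P i) F i) = \sum_(i <- r | P i) rees_val (F i).
Proof. exact: (raddf_sum (\val : B -> _)). Qed.

Definition rees_mono n a := rees_of (a *: 'X^n).

Lemma rees_monoK n a : ideal_exp I n a -> rees_val (rees_mono n a) = a *: 'X^n.
Proof.
move=> Ia; apply: rees_ofK => i; rewrite coefZ coefXn.
by case: eqP => [->|_]; rewrite ?mulr1 ?mulr0 //; apply: ideal0.
Qed.

Lemma coef_rees_monoM a f n : I a ->
  (rees_val (rees_mono 1 a * f))`_n.+1 = a * (rees_val f)`_n.
Proof.
move=> Ia; rewrite rees_valM rees_monoK ?ideal_exp1 //.
by rewrite -scalerAl coefZ expr1 coefXM.
Qed.

Lemma coef_rees_monoM0 a f : I a -> (rees_val (rees_mono 1 a * f))`_0 = 0.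
Proof.
move=> Ia; rewrite rees_valM rees_monoK ?ideal_exp1 //.
by rewrite -scalerAl coefZ expr1 coefXM mulr0.
Qed.

(* [f] lies in [c R[Lt]] *)
Definition coef_in c L f := forall n, ideal_mul c (ideal_exp L n) (rees_val f)`_n.

Lemma coef_in0 c L : coef_in c L 0.
Proof. by move=> n; rewrite rees_val0 coef0; apply: ideal0. Qed.

Lemma coef_in1 L : coef_in (unit_ideal R) L 1.
Proof.
by move=> [|n]; rewrite rees_val1 coef1 ideal_mul1 //; apply: ideal0.
Qed.

Lemma coef_inD c L f g : coef_in c L f -> coef_in c L g -> coef_in c L (f + g).
Proof. by move=> cf cg n; rewrite rees_valD coefD; apply: idealD. Qed.

Lemma coef_inB c L f g : coef_in c L f -> coef_in c L g -> coef_in c L (f - g).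
Proof. by move=> cf cg n; rewrite rees_valB coefB; apply: idealB. Qed.

Lemma coef_inM c L f g :
  coef_in (unit_ideal R) L f -> coef_in c L g -> coef_in c L (f * g).
Proof.
move=> cf cg n; rewrite rees_valM coefM; apply: ideal_sum => i _.
rewrite -[in ideal_exp L n](subnKC (ltn_ord i : (i <= n)%N)) -ideal_expD.
rewrite ideal_mulA (ideal_mulC c) -ideal_mulA; apply: mem_ideal_mul => //.
by have := cf i; rewrite ideal_mul1.
Qed.

Lemma coef_inS c c' L L' f : c `<=` c' -> L `<=` L' ->
  coef_in c L f -> coef_in c' L' f.
Proof.
move=> cc LL cf n; apply: ideal_mulS (cf n) => //; exact: ideal_expS.
Qed.

Lemma coef_in_rees f : coef_in (unit_ideal R) I f.
Proof. by move=> n; rewrite ideal_mul1; apply: rees_coef. Qed.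

(** The ideal factored out in [fibre_ring], named so that prime chains can be handled in R[It]
    before passing to the quotient. *)
Definition rees_max (m : ideal R) : ideal B :=
  ideal_span [set f | exists2 a, m a & rees_val f = a%:P].

Lemma coef_in_closed c : ideal_closed (coef_in c I).
Proof.
split; [exact: coef_in0|exact: coef_inD|].
by move=> f g cg; apply: coef_inM => //; apply: coef_in_rees.
Qed.

(** For the converse direction [f] is the sum of its homogeneous terms, and a term with coefficient
    in m I^n is a sum of constants from [m] times elements of degree n. *)
Lemma rees_maxP m f : rees_max m f <-> coef_in m I f.
Proof.
split=> [|mf].
  apply: (@ideal_span_le _ _ (Ideal (coef_in_closed m))) => g [a ma eg] [|n];
    rewrite eg coefC; last exact: ideal0.
  by rewrite ideal_mul_exp0.
have closed n : ideal_closed [set a | exists2 g : B, rees_max m g &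
    rees_val g = a *: 'X^n].
  split=> [|a b [g mg eg] [h mh eh]|a b [g mg eg]].
  - by exists 0; [apply: ideal0|rewrite rees_val0 scale0r].
  - exists (g + h); first exact: idealD.
    by rewrite rees_valD eg eh scalerDl.
  - exists (rees_mono 0 a * g); first exact: idealM.
    rewrite rees_valM rees_monoK // eg expr0 -scalerAl mul1r scalerA.
    by [].
have mono n a : ideal_mul m (ideal_exp I n) a ->
    exists2 g : B, rees_max m g & rees_val g = a *: 'X^n.
  apply: (@ideal_mul_ind _ _ _ (Ideal (closed n))) => x y mx Iy.
  exists (rees_mono 0 x * rees_mono n y).
    apply: idealMr; apply: sub_ideal_span; exists x => //.
    by rewrite rees_monoK // expr0 alg_polyC.
  by rewrite rees_valM !rees_monoK // expr0 -scalerAl mul1r scalerA.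
have /choice[h hE] n : exists g : B, rees_max m g /\
    rees_val g = (rees_val f)`_n *: 'X^n.
  by have [g mg eg] := mono n _ (mf n); exists g.
have -> : f = \sum_(n < size (rees_val f)) h n.
  apply: rees_val_inj; rewrite rees_val_sum -[LHS]coefK poly_def.
  by apply: eq_bigr => n _; have [_ ->] := hE n.
by apply: ideal_sum => n _; have [] := hE n.
Qed.

(* Multiplicative sets in the rings [R[(s)t]]: a prime of [R[It]] avoiding
   [collapse (w :: s)] can be enlarged, after adding [wt], to one avoiding
   [collapse s]. *)
Fixpoint collapse s : set B :=
  if s is w :: s' then
    [set f | exists n sg a, [/\ collapse s' sg,
       coef_in (unit_ideal R) (ideal_span [set` s]) a &
       f = rees_mono 1 w ^+ n * (sg + rees_mono 1 w * a)]]
  else [set 1].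

Lemma coef_in_mono w L : I w -> L w ->
  coef_in (unit_ideal R) L (rees_mono 1 w).
Proof.
move=> Iw Lw n; rewrite ideal_mul1 rees_monoK ?ideal_exp1 // coefZ coefXn.
case: eqP => [->|_]; last by rewrite mulr0; apply: ideal0.
by rewrite mulr1 ideal_exp1.
Qed.

Lemma span_cons_sub w s :
  ideal_span [set` s] `<=` ideal_span [set` w :: s].
Proof. by apply: sub_mem_span => x xs; rewrite inE xs orbT. Qed.

Lemma span_cons_head w s : ideal_span [set` w :: s] w.
Proof. by apply: sub_ideal_span; rewrite /= mem_head. Qed.

Lemma coef_in_exp L f n : coef_in (unit_ideal R) L f ->
  coef_in (unit_ideal R) L (f ^+ n).
Proof.
move=> Lf; elim: n => [|n IH]; first exact: coef_in1.
by rewrite exprS; apply: coef_inM.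
Qed.

Lemma collapse_coef_in s f : [set` s] `<=` I -> collapse s f ->
  coef_in (unit_ideal R) (ideal_span [set` s]) f.
Proof.
elim: s f => [|w s IH] f sI; first by move->; apply: coef_in1.
move=> [n [sg [a [Ssg La ->]]]].
have Iw : I w by apply: sI; apply: mem_head.
have Lw := coef_in_mono Iw (@span_cons_head w s).
apply: coef_inM; first exact: coef_in_exp.
apply: coef_inD; last exact: coef_inM.
apply: coef_inS (IH _ _ Ssg) => //; first exact: span_cons_sub.
by move=> x xs; apply: sI; rewrite /= inE (xs : x \in s) orbT.
Qed.

Lemma collapse_mult_set s : [set` s] `<=` I -> mult_set (collapse s).
Proof.
elim: s => [|w s IH] sI; first by split=> // _ _ -> ->; rewrite mul1r.
have sI' : [set` s] `<=` I.
  by move=> x xs; apply: sI; rewrite /= inE (xs : x \in s) orbT.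
have Iw : I w by apply: sI; apply: mem_head.
have Lw := coef_in_mono Iw (@span_cons_head w s).
have [S1 SM] := IH sI'.
have Lsg sg : collapse s sg ->
    coef_in (unit_ideal R) (ideal_span [set` w :: s]) sg.
  by move=> /(collapse_coef_in sI'); apply: coef_inS => //; apply: span_cons_sub.
split.
  exists 0%N, 1, 0; split=> //; first exact: coef_in0.
  by rewrite mulr0 addr0 expr0 mulr1.
move=> _ _ [i [f [a [Sf La ->]]]] [j [g [b [Sg Lb ->]]]].
exists (i + j)%N, (f * g), (f * b + g * a + rees_mono 1 w * (a * b)); split.
- exact: SM.
- apply: coef_inD; last by apply: coef_inM => //; apply: coef_inM.
  by apply: coef_inD; apply: coef_inM => //; apply: Lsg.
- by rewrite exprD; ring.
Qed.

Lemma collapse_head w s : [set` w :: s] `<=` I -> collapse (w :: s) (rees_mono 1 w).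
Proof.
move=> sI; have [|S1 _] := @collapse_mult_set s.
  by move=> x xs; apply: sI; rewrite /= inE (xs : x \in s) orbT.
exists 1%N, 1, 0; split=> //; first exact: coef_in0.
by rewrite mulr0 addr0 mulr1.
Qed.

(** Factors wt are cancelled by [weakly_regular_nzd_mul]; what remains, sg + wt a, is reduced to
    [sg] by [weakly_regular_contract]. The head of the list is the last entry of the regular
    sequence, hence the [rev]. *)
Lemma collapse_disjoint (m : ideal R) s f : ~ m 1 -> [set` s] `<=` I ->
  [set` s] `<=` m -> weakly_regular (rev s) -> collapse s f ->
  ~ coef_in m (ideal_span [set` s]) f.
Proof.
move=> m1; elim: s f => [|w s IH] f sI sm.
  move=> _ -> /(_ 0%N); rewrite rees_val1 coef1 ideal_mul_exp0.
  exact: m1.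
rewrite rev_cons => reg [n [sg [a [Ssg La ->]]]].
have sI' : [set` s] `<=` I.
  by move=> x xs; apply: sI; rewrite /= inE (xs : x \in s) orbT.
have sm' : [set` s] `<=` m.
  by move=> x xs; apply: sm; rewrite /= inE (xs : x \in s) orbT.
have Iw : I w by apply: sI; apply: mem_head.
have mw : m w by apply: sm; apply: mem_head.
have erev t : ideal_span [set` rev t] = ideal_span [set` t].
  by apply: eq_mem_span => x; rewrite mem_rev.
have reg' : weakly_regular (rev s) by have [] := weakly_regular_rcons reg.
have eL : ideal_span [set` rcons (rev s) w] = ideal_span [set` w :: s].
  by rewrite -rev_cons erev.
elim: n => [|n IHn].
  rewrite expr0 mul1r => mf; apply: (IH sg) => // n.
  (* The coefficient of wt a in degree n is [w] times the one of [a] in degree n-1, and 0 in degree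
     0; [v] moves it to the other side. *)
  pose v := if n is n'.+1 then - (rees_val a)`_n' else 0.
  rewrite -erev; apply: (weakly_regular_contract reg mw (v := v)
    (u := (rees_val (sg + rees_mono 1 w * a))`_n)).
  - by have := @collapse_coef_in s sg sI' Ssg n; rewrite ideal_mul1 erev.
  - rewrite rees_valD coefD /v; case: n {mf v} => [|n].
      by rewrite coef_rees_monoM0 // mulr0 add0r addr0.
    by rewrite coef_rees_monoM // mulrN addrCA addNr addr0.
  - by rewrite eL; apply: mf.
rewrite exprS -mulrA => mf; apply: IHn => i.
have := mf i.+1; rewrite coef_rees_monoM // -eL.
apply: weakly_regular_nzd_mul => //.
by rewrite erev; apply: ideal_span_le.
Qed.

(** Modulo wt the subring R[(w, s)t] shrinks to R[(s)t]. The cofactor [h] is only needed in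
    R[It]. *)
Lemma coef_in_split w s f : [set` w :: s] `<=` I ->
  coef_in (unit_ideal R) (ideal_span [set` w :: s]) f ->
  exists g h, coef_in (unit_ideal R) (ideal_span [set` s]) g /\
    f = g + rees_mono 1 w * h.
Proof.
move=> sI Lf; have Iw : I w by apply: sI; apply: mem_head.
have sI' : ideal_span [set` s] `<=` I.
  by apply: ideal_span_le => x xs; apply: sI; rewrite /= inE (xs : x \in s) orbT.
have LI : ideal_span [set` w :: s] `<=` I by apply: ideal_span_le.
have /choice[d dE] n : exists d : R * R,
    [/\ ideal_exp I n d.1, ideal_exp (ideal_span [set` s]) n.+1 d.2 &
     (rees_val f)`_n.+1 = w * d.1 + d.2].
  have := Lf n.+1; rewrite ideal_mul1 -[w :: s]cat0s span_middle cat0s.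
  move=> /ideal_exp_lin[a [b [La Lb ->]]]; exists (a, b); split=> //.
  apply: ideal_expS La => x xL; apply: LI.
  by rewrite -[w :: s]cat0s span_middle cat0s.
set N := size (rees_val f).
(* The constant term belongs to [g] whole, since the zeroth power of (s) is the unit ideal. The
   choices [d] are cut off at [N] to obtain polynomials; beyond it the coefficients of [f]
   vanish. *)
pose gq := ((rees_val f)`_0)%:P + 'X * \poly_(n < N) (d n).2.
pose hq := \poly_(n < N) (d n).1.
have gc n : ideal_exp (ideal_span [set` s]) n gq`_n.
  case: n => [//|n].
  have -> : gq`_n.+1 = if (n < N)%N then (d n).2 else 0.
    by rewrite coefD coefC coefXM /= add0r coef_poly.
  case: ifP => _; last exact: ideal0.
  by have [] := dE n.
have gK : rees_val (rees_of gq) = gq.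
  by apply: rees_ofK => n; apply: ideal_expS (gc n).
have hK : rees_val (rees_of hq) = hq.
  apply: rees_ofK => n; rewrite coef_poly; case: ifP => _; last exact: ideal0.
  by have [] := dE n.
exists (rees_of gq), (rees_of hq); split=> [n|].
  by rewrite gK ideal_mul1.
apply: rees_ext => -[|n]; rewrite rees_valD coefD gK.
  by rewrite coef_rees_monoM0 // addr0 coefD coefC coefXM addr0.
rewrite coef_rees_monoM // hK coefD coefC coefXM /= add0r !coef_poly.
case: ltnP => [_|Nn]; first by have [_ _ ->] := dE n; rewrite addrC.
by rewrite mulr0 addr0 nth_default // (leq_trans Nn).
Qed.

(** A prime over [Q] avoiding [collapse (w :: s)] omits y = wt. Once y is added to it, the [e j]
    still generate, now over R[(s)t], and integrality shows that [collapse s] is still avoided, so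
    the induction continues. *)
Lemma going_up s (Q : ideal B) k (e : 'I_k -> B) : [set` s] `<=` I ->
  (forall f, Q f -> collapse s f -> False) ->
  (forall b : B, exists2 c : 'I_k -> B,
     forall j, coef_in (unit_ideal R) (ideal_span [set` s]) (c j) &
     Q (b - \sum_j c j * e j)) ->
  exists2 P, prime_chain (size s) P & Q `<=` P 0%N.
Proof.
elim: s Q => [|w s IH] Q sI QS gen.
  have [P [Pp QP _]] := prime_disjoint (collapse_mult_set sI) QS.
  by exists (fun=> P) => //; split=> -[].
have [P0 [P0p QP0 P0S]] := prime_disjoint (collapse_mult_set sI) QS.
have sI' : [set` s] `<=` I.
  by move=> x xs; apply: sI; rewrite /= inE (xs : x \in s) orbT.
have Iw : I w by apply: sI; apply: mem_head.
have Lw := coef_in_mono Iw (@span_cons_head w s).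
set y := rees_mono 1 w in Lw *.
set L := ideal_span [set` w :: s] in Lw gen.
pose Q' := ideal_lin y (unit_ideal B) P0.
have [|||P Pc Q'P] := IH Q'.
- exact: sI'.
- move=> sg [b [q [_ P0q esg]]] Ssg.
  have [c1 _ Qc1] := gen 1.
  (* If sg = y b + q with [q] in [P0], multiplication by [sg] sends each generator into y times the
     R[(w, s)t]-span of all of them modulo [P0]. The trick gives sg^k - y a in [P0] with [a] in the
     subring: precisely an element that [collapse (w :: s)] was designed to contain. *)
  have [_ [a La ->] Pal] : exists2 al,
      [set x | exists2 a, coef_in (unit_ideal R) L a & x = y * a] al &
      P0 (sg ^+ k - al).
    apply: (@determinant_trick _ _ (coef_in (unit_ideal R) L)
              _ _ _ _ _ _ _ _ _ e c1).
    - exact: coef_in1.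
    - exact: coef_inB.
    - exact: coef_inM.
    - by move=> _ [a La ->]; apply: coef_inM.
    - by exists 0; [apply: coef_in0|rewrite mulr0].
    - move=> _ _ [a La ->] [a' La' ->]; exists (a + a'); first exact: coef_inD.
      by rewrite mulrDr.
    - move=> x _ Lx [a La ->]; exists (x * a); first exact: coef_inM.
      by rewrite mulrCA.
    - by apply: coef_inS (collapse_coef_in sI' Ssg) => //; apply: span_cons_sub.
    - exact: QP0.
    - move=> i; have [c Lc Qc] := gen (b * e i).
      exists (fun j => y * c j); split; first by move=> j; exists (c j).
      have -> : sg * e i - \sum_j y * c j * e j =
          y * (b * e i - \sum_j c j * e j) + q * e i.
        have -> : \sum_j y * c j * e j = y * \sum_j c j * e j.
          by rewrite mulr_sumr; apply: eq_bigr => j _; rewrite mulrA.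
        by rewrite esg; ring.
      by apply: idealD; [apply/idealM/QP0|apply: idealMr].
  apply: P0S Pal _; exists 0%N, (sg ^+ k), (- a); split.
  + have [S1 SM] := collapse_mult_set sI'.
    have : forall n, collapse s (sg ^+ n); last by apply.
    by elim=> [//|n IHn]; rewrite exprS; apply: SM.
  + by rewrite -sub0r; apply: coef_inB => //; apply: coef_in0.
  + by rewrite expr0 mul1r mulrN.
- move=> b; have [c Lc Qc] := gen b.
  have /choice[d dE] j : exists d : B * B,
      coef_in (unit_ideal R) (ideal_span [set` s]) d.1 /\ c j = d.1 + y * d.2.
    by have [g [h [Lg eg]]] := coef_in_split sI (Lc j); exists (g, h).
  exists (fun j => (d j).1) => [j|]; first by have [] := dE j.
  have -> : b - \sum_j (d j).1 * e j =
      y * (\sum_j (d j).2 * e j) + (b - \sum_j c j * e j).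
    have -> : \sum_j c j * e j = \sum_j (d j).1 * e j + y * (\sum_j (d j).2 * e j).
      rewrite mulr_sumr -big_split; apply: eq_bigr => j _.
      by have [_ ->] := dE j; rewrite mulrDl mulrA.
    by ring.
  by apply: idealD; [apply: mem_lin_l|apply/mem_lin_r/QP0].
exists (fun i => if i is i'.+1 then P i' else P0) => //.
apply: prime_chain_cons => //; apply: (proper_ideal (x := y)).
- by move=> x P0x; apply: Q'P; apply: mem_lin_r.
- by apply: Q'P; rewrite -[X in ideal_set _ X]mulr1; apply: mem_lin_l.
- by move=> P0y; apply: (P0S y) => //; apply: collapse_head.
Qed.

End ReesAlgebra.

(** * Chains of primes in the fibre ring *)

Section QuotientChains.
Variables (A : comPzRingType) (K : ideal A).
Local Notation AK := (quotient_ring K).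
Local Notation pi := (@to_quotient A K).

Lemma to_quotient_mul x y : pi (x * y) = pi x * pi y.
Proof. by rewrite -to_quotientM. Qed.

Lemma to_quotient0 : pi 0 = 0.
Proof. by apply: (addIr (pi 0)); rewrite -to_quotientD !add0r. Qed.

Lemma quot_preim_closed (Q : ideal AK) : ideal_closed [set a | Q (pi a)].
Proof.
split=> [|a b Qa Qb|a x Qx]; rewrite /mkset.
- by rewrite to_quotient0; apply: ideal0.
- by rewrite to_quotientD; apply: idealD.
- by rewrite to_quotient_mul; apply: idealM.
Qed.
Definition quot_preim (Q : ideal AK) : ideal A := Ideal (quot_preim_closed Q).

Lemma quot_preimP (Q : ideal AK) a : quot_preim Q a <-> Q (pi a).
Proof. by []. Qed.

Lemma prime_quot_preim (Q : ideal AK) : prime_ideal Q -> prime_ideal (quot_preim Q).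
Proof.
move=> [Q1 QM]; split=> [/quot_preimP //|x y].
by move=> /quot_preimP; rewrite to_quotient_mul => /QM.
Qed.

Lemma sub_quot_preim (Q : ideal AK) : K `<=` quot_preim Q.
Proof.
move=> a Ka; apply/quot_preimP.
rewrite (_ : pi a = pi 0); last by apply: to_quotient_eq; rewrite subr0.
by rewrite to_quotient0; apply: ideal0.
Qed.

Lemma prime_chain_quot_preim n (Q : nat -> ideal AK) : prime_chain n Q ->
  prime_chain n (fun i => quot_preim (Q i)).
Proof.
move=> [Qp QS]; split=> i ilen; first by apply/prime_quot_preim/Qp.
have [sub _] := QS i ilen; have [x Qx nQx] := ideal_properP (QS i ilen).
rewrite -[x]to_quotientK in Qx nQx.
by apply: (proper_ideal (x := repr x)) => // a; apply: sub.
Qed.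

Section Image.
Variables (P : ideal A) (KP : K `<=` P).

Lemma quot_repr a : P (repr (pi a)) <-> P a.
Proof.
have Ka := KP (to_quotient_repr K a); split=> Pa.
- by rewrite -[a](subKr (repr (pi a))); apply: idealB.
- by rewrite -[repr _](subrK a); apply: idealD.
Qed.

Lemma quot_image_closed : ideal_closed [set x : AK | P (repr x)].
Proof.
split=> [|x y Px Py|a x Px].
- by rewrite -to_quotient0; apply/quot_repr; apply: ideal0.
- rewrite -[x]to_quotientK -[y]to_quotientK -to_quotientD.
  by apply/quot_repr; apply: idealD.
- rewrite -[a]to_quotientK -[x]to_quotientK -to_quotient_mul.
  by apply/quot_repr; apply: idealM.
Qed.
Definition quot_image : ideal AK := Ideal quot_image_closed.

Lemma quot_imageP a : quot_image (pi a) <-> P a.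
Proof. exact: quot_repr. Qed.

Lemma prime_quot_image : prime_ideal P -> prime_ideal quot_image.
Proof.
move=> [P1 PM]; split; first by move/quot_imageP.
move=> x y; rewrite -[x]to_quotientK -[y]to_quotientK -to_quotient_mul.
by move=> /quot_imageP/PM[]; [left|right]; apply/quot_imageP.
Qed.

End Image.

Lemma prime_chain_quot_image n P : prime_chain n P -> K `<=` P 0%N ->
  exists Q : nat -> ideal AK, prime_chain n Q.
Proof.
move=> Pc KP0; have KP i : (i <= n)%N -> K `<=` P i.
  by move=> ilen x /KP0; apply: (prime_chain_sub Pc).
pose Q i := if pselect (i <= n)%N is left h then quot_image (KP i h)
            else unit_ideal AK.
have [Pp PS] := Pc; exists Q; split=> i ilen; rewrite /Q.
  by case: pselect => // h; apply/prime_quot_image/Pp.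
case: pselect => [h|]; last by rewrite (ltnW ilen).
case: pselect => // h'; have [sub _] := PS i ilen.
have [a Pa nPa] := ideal_properP (PS i ilen).
apply: (proper_ideal (x := pi a)).
- by move=> x; rewrite -[x]to_quotientK => /quot_imageP ?; apply/quot_imageP/sub.
- exact/quot_imageP.
- by move/quot_imageP.
Qed.

End QuotientChains.

Lemma mul_span_sum (A : comPzRingType) (K : ideal A) (ws : seq A) x :
  ideal_mul K (ideal_span [set` ws]) x ->
  exists d : nat -> A, (forall j, K (d j)) /\
    x = \sum_(j < size ws) d j * ws`_j.
Proof.
elim/last_ind: ws x => [|s w IH] x.
  move=> /ideal_mul_ler/span_nil->; exists (fun=> 0); rewrite big_ord0.
  by split=> // j; apply: ideal0.
rewrite span_rcons => /mul_ideal_lin[a [b [/ideal_mul_lel Ka /IH[d [Kd ->]] ->]]].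
exists (fun i => if (i < size s)%N then d i else a); split.
  by move=> j; case: ifP.
rewrite size_rcons big_ord_recr /= ltnn nth_rcons ltnn eqxx addrC mulrC.
by congr (_ + _); apply: eq_bigr => i _; rewrite nth_rcons ltn_ord.
Qed.

Section ReesChain.
Variables (R : comNzRingType) (I J : ideal R) (ws : seq R).
Local Notation B := (rees_algebra I).
Hypotheses (JI : J `<=` I) (eI : I = ideal_span [set` ws]).
Hypothesis redI : forall n, ideal_exp I n.+1 `<=` ideal_mul (ideal_exp J n) I.

Definition rees_gen (j : 'I_(size ws).+1) : B :=
  if nat_of_ord j is j'.+1 then rees_mono I 1 ws`_j' else 1.

(** As I^(n+1) lies in J^n I, generators in degrees 0 and 1 suffice over R[Jt]. The ideal [c] is
    carried along: c = R gives finiteness, and c = [m] describes m R[It] by coefficients in m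
    R[Jt]. *)
Lemma rees_module_finite c (f : B) : coef_in c I f ->
  exists p : 'I_(size ws).+1 -> B, (forall j, coef_in c J (p j)) /\
    f = \sum_j p j * rees_gen j.
Proof.
move=> cf; have /choice[d dE] n : exists d : nat -> R,
    (forall j, ideal_mul c (ideal_exp J n) (d j)) /\
    (rees_val f)`_n.+1 = \sum_(j < size ws) d j * ws`_j.
  apply: mul_span_sum; rewrite -eI -ideal_mulA.
  by apply: ideal_mulS (cf n.+1).
set N := size (rees_val f).
pose q j := if j is j'.+1 then \poly_(n < N) d n j' else ((rees_val f)`_0)%:P.
have cq j n : ideal_mul c (ideal_exp J n) (q j)`_n.
  case: j => [|j]; rewrite /q ?coefC ?coef_poly; case: ifP => [|_].
  - by move=> /eqP->; have := cf 0%N; rewrite !ideal_mul_exp0.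
  - exact: ideal0.
  - by have [cd _] := dE n.
  - exact: ideal0.
have qK j : rees_val (rees_of I (q j)) = q j.
  apply: rees_ofK => n; apply: (ideal_expS JI); exact: ideal_mul_ler (cq j n).
exists (fun j => rees_of I (q j)); split=> [j n|]; first by have := cq j n;
  rewrite -{1}(qK j).
have Iw j : (j < size ws)%N -> I ws`_j by rewrite eI; apply: mem_span_nth.
apply: rees_ext => n; rewrite rees_val_sum coef_sum big_ord_recl.
rewrite {1}/rees_gen mulr1 qK.
under eq_bigr => j _ do rewrite /rees_gen mulrC.
case: n => [|n].
  rewrite big1 ?addr0; first by rewrite coefC.
  by move=> j _; apply: coef_rees_monoM0; apply: Iw.
under eq_bigr => j _ do rewrite (coef_rees_monoM _ _ (Iw _ (ltn_ord j))) qK.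
rewrite coefC add0r /q.
have [ltnN|leNn] := ltnP n N.
  have [_ ->] := dE n; apply: eq_bigr => j _.
  by rewrite coef_poly ltnN mulrC.
rewrite nth_default ?(leq_trans leNn) // big1 // => j _.
by rewrite coef_poly ltnNge leNn mulr0.
Qed.

End ReesChain.

(** This is [going_up] started at m R[It] with the reversed sequence. The point to check is that m
    R[It] misses the first multiplicative set, although regularity only controls m R[Jt]. *)
Lemma rees_prime_chain (R : comNzRingType) (m I : ideal R) (z : seq R) :
  noetherian R -> ~ m 1 -> weakly_regular z -> [set` z] `<=` m ->
  [set` z] `<=` I ->
  (forall n, ideal_exp I n.+1 `<=`
     ideal_mul (ideal_exp (ideal_span [set` z]) n) I) ->
  exists2 P : nat -> ideal (rees_algebra I),
    prime_chain (size z) P & rees_max I m `<=` P 0%N.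
Proof.
move=> hR m1 reg zm zI redI; have [ws eI] := hR I.
set J := ideal_span _ in redI.
have JI : J `<=` I by apply: ideal_span_le.
have fin := rees_module_finite JI eI redI.
have erev : ideal_span [set` rev z] = J.
  by apply: eq_mem_span => x; rewrite mem_rev.
have revI : [set` rev z] `<=` I by move=> x; rewrite /= mem_rev; apply: zI.
rewrite -(size_rev z).
apply: (@going_up _ _ _ _ _ (rees_gen I (ws := ws)) revI) => [sg msg Ssg|b].
- have [c1 [_ e1]] := fin _ 1 (@coef_in_rees _ I 1).
  pose O := ideal_span [set` ([::] : seq (rees_algebra I))].
  (* An element of R[Jt] in m R[It] has a power in m R[Jt]; the trick is applied modulo the zero
     ideal [O]. *)
  have [al mal O0] : exists2 al, coef_in m J al & O (sg ^+ (size ws).+1 - al).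
    apply: (@determinant_trick _ _ (coef_in (unit_ideal R) J)
              _ _ _ _ _ _ _ _ _ (rees_gen I (ws := ws)) c1).
    + exact: coef_in1.
    + exact: coef_inB.
    + exact: coef_inM.
    + by move=> f; apply: coef_inS.
    + exact: coef_in0.
    + exact: coef_inD.
    + exact: coef_inM.
    + by rewrite -erev; apply: collapse_coef_in.
    + by rewrite -e1 subrr; apply: ideal0.
    + move=> i; have [p [mp ep]] : exists p : 'I_(size ws).+1 -> rees_algebra I,
          (forall j, coef_in m J (p j)) /\
          sg * rees_gen I (ws := ws) i = \sum_j p j * rees_gen I j.
        by apply: fin; apply/rees_maxP/idealMr.
      by exists p; split=> //; rewrite ep subrr; apply: ideal0.
  have {}O0 : sg ^+ (size ws).+1 = al by apply/eqP; rewrite -subr_eq0;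
    apply/eqP/span_nil.
  have [S1 SM] := collapse_mult_set revI.
  have Sn n : collapse (rev z) (sg ^+ n).
    by elim: n => [|n IHn]; rewrite ?expr0 // exprS; apply: SM.
  have := Sn (size ws).+1; rewrite O0 => Sal.
  have revm : [set` rev z] `<=` m by move=> x; rewrite /= mem_rev; apply: zm.
  have := collapse_disjoint m1 revI revm; rewrite revK => /(_ _ reg Sal).
  by rewrite erev.
- have [c [Lc ->]] := fin _ b (@coef_in_rees _ I b).
  by exists c; [rewrite erev|rewrite subrr; apply: ideal0].
Qed.

(** * Monomial counting *)

Section LinearDependence.
Variables (A : comPzRingType) (m : ideal A) (hm : local_ring m).

(** Gaussian elimination over the residue field, one coordinate at a time: a coordinate that is not
    everywhere in [m] supplies a unit pivot, and its row is removed. *)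
Lemma local_dependence_nat (T : finType) r (S : {set T}) (c : T -> nat -> A) :
  (r < #|S|)%N -> exists d : T -> A,
    (exists2 i, i \in S & ~ m (d i)) /\
    forall l, (l < r)%N -> m (\sum_(i in S) d i * c i l).
Proof.
elim: r S c => [|r IH] S c.
  move=> /card_gt0P[i Si]; exists (fun=> 1); split=> //.
  by exists i => //; apply: maximal_proper.
move=> rS; have [mc|] := pselect (forall i, i \in S -> m (c i r)).
  have [d [d1 md]] := IH S c (ltnW rS); exists d; split=> // l.
  rewrite ltnS leq_eqVlt => /predU1P[->|/md//].
  by apply: ideal_sum => i /mc; apply: idealM.
move=> /existsNP[i0 /not_implyP[Si0 /(local_unit hm)[v cv]]].
have cS : (r < #|S :\ i0|)%N by move: rS; rewrite (cardsD1 i0) Si0.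
have [d [[i Si di] md]] := IH (S :\ i0)
  (fun i l => c i l - c i r * v * c i0 l) cS.
(* The pivot row gets the coefficient that undoes the elimination; coordinate [r] then vanishes
   exactly. *)
pose d' i := if i == i0 then - \sum_(i in S :\ i0) d i * (c i r * v) else d i.
exists d'; split.
  move: Si; rewrite !inE => /andP[ni Si]; exists i => //.
  by rewrite /d' (negPf ni).
move=> l lr; rewrite (big_setD1 i0) //= {1}/d' eqxx.
have -> : \sum_(i in S :\ i0) d' i * c i l = \sum_(i in S :\ i0) d i * c i l.
  by apply: eq_bigr => j; rewrite !inE /d' => /andP[/negPf-> _].
rewrite mulNr mulr_suml addrC -sumrB.
under eq_bigr => j _ do rewrite -mulrA -mulrBr.
move: lr; rewrite ltnS leq_eqVlt => /predU1P[->|/md//].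
rewrite big1 ?ideal0 //; first exact: ideal0.
by move=> j _; rewrite -mulrA (mulrC v) cv mulr1 subrr mulr0.
Qed.

Lemma local_dependence (T L : finType) (c : T -> L -> A) :
  (#|L| < #|T|)%N -> exists d : T -> A,
    (exists i, ~ m (d i)) /\ forall l, m (\sum_i d i * c i l).
Proof.
rewrite -[#|T|]cardsT => LT.
pose c' i n := if insub n is Some j then c i (enum_val (j : 'I_#|L|)) else 0.
have [d [[i _ di] md]] := local_dependence_nat c' LT.
exists d; split=> [|l]; first by exists i.
have := md _ (ltn_ord (enum_rank l)).
under eq_bigr => j _ do rewrite /c' valK enum_rankK.
by rewrite (eq_bigl xpredT) // => j; rewrite inE.
Qed.

End LinearDependence.

Section Monomials.
Variable N : nat.

(** Exponent vectors with entries below [N], as nested pairs so that [mon] peels off one variable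
    for each step of a prime chain. *)
Fixpoint expo k : finType :=
  if k is k'.+1 then ('I_N * expo k')%type : finType else unit.

Lemma card_expo k : #|expo k| = (N ^ k)%N.
Proof.
by elim: k => [|k IH]; rewrite ?card_unit // card_prod card_ord IH expnS.
Qed.

Variables (A : comPzRingType) (B : comPzRingType).

Fixpoint mon (x : nat -> B) k : expo k -> B :=
  if k is k'.+1 then fun a => x 0%N ^+ a.1 * mon (fun i => x i.+1) a.2
  else fun=> 1.

(** Modulo [Q] only the lowest term survives, so [s 0] is in [Q], hence in [P]; the rest is
    divisible by [x], which the prime [P] allows to be cancelled. *)
Lemma prime_lowest_term (P Q : ideal B) x M (s : 'I_M -> B) :
  prime_ideal P -> P `<=` Q -> Q x -> ~ P x ->
  (forall i, Q (s i) -> P (s i)) ->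
  P (\sum_(i < M) x ^+ i * s i) -> forall i, P (s i).
Proof.
move=> [_ PM] PQ Qx Px QP; elim: M s QP => [|M IH] s QP; first by move=> _ [].
rewrite big_ord_recl expr0 mul1r.
have -> : \sum_(i < M) x ^+ lift ord0 i * s (lift ord0 i) =
    x * \sum_(i < M) x ^+ i * s (lift ord0 i).
  by rewrite mulr_sumr; apply: eq_bigr => i _; rewrite exprS mulrA.
move=> Ps; have Ps0 : P (s ord0).
  apply: QP; rewrite -[s ord0](addrK (x * \sum_(i < M) x ^+ i * s (lift ord0 i))).
  by apply: idealB; [apply: PQ|apply: idealMr].
have /PM[//|Pt] := idealDr Ps0 Ps.
move=> i; case: (unliftP ord0 i) => [j ->|-> //].
by apply: (IH (fun j => s (lift ord0 j))) => // l; apply: QP.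
Qed.

(** Grouping by powers of [x 0], the chain starting at [P 1] shows that a coefficient polynomial in
    [P 1] has all its coefficients in [m], hence lies in [P 0]; this is what [prime_lowest_term]
    requires. *)
Lemma prime_chain_independent (m : ideal A) (phi : A -> B) k
    (P : nat -> ideal B) x (c : expo k -> A) :
  prime_chain k P -> (forall i, (i < k)%N -> P i.+1 (x i) /\ ~ P i (x i)) ->
  (forall a, m a -> P 0%N (phi a)) -> (forall a, P k (phi a) -> m a) ->
  P 0%N (\sum_j phi (c j) * mon x j) -> forall j, m (c j).
Proof.
elim: k P x c => [|k IH] P x c Pc xP mP Pm.
  rewrite (bigD1 tt) //= big1 => [|[]//]; rewrite addr0 mulr1 => /Pm mc [].
  exact: mc.
have P01 : P 0%N `<=` P 1%N by apply: (prime_chain_sub Pc).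
pose s (a : 'I_N) := \sum_(b : expo k) phi (c (a, b)) * mon (fun i => x i.+1) b.
have -> : \sum_j phi (c j) * mon x j = \sum_(a < N) x 0%N ^+ a * s a.
  under [RHS]eq_bigr => a _ do rewrite mulr_sumr.
  rewrite pair_bigA; apply: eq_bigr => -[a b] _ /=.
  by rewrite mulrCA.
have cm a : P 1%N (s a) -> forall b, m (c (a, b)).
  apply: (IH (fun i => P i.+1) (fun i => x i.+1)) => //.
  - by split=> i ik; [apply: Pc.1|apply: Pc.2].
  - by move=> i ik; apply: xP.
  - by move=> r /mP/P01.
have [x1 nx0] := xP 0%N (ltn0Sn k).
have P0p : prime_ideal (P 0%N) by apply: Pc.1.
move=> /(prime_lowest_term P0p P01 x1 nx0) H [a b]; apply: (cm).
apply/P01/H => {}a /cm mc; apply: ideal_sum => b' _.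
by apply/idealMr/mP.
Qed.

End Monomials.

(** * Spanning the Rees algebra modulo [m] by monomials *)

Section ReesSpan.
Variables (R : comNzRingType) (m I : ideal R).
Local Notation B := (rees_algebra I).

Definition rees_const a : B := rees_mono I 0 a.

Lemma rees_constK a : rees_val (rees_const a) = a%:P.
Proof. by rewrite rees_monoK // expr0 alg_polyC. Qed.

Lemma rees_constD a b : rees_const (a + b) = rees_const a + rees_const b.
Proof. by apply: rees_val_inj; rewrite rees_valD !rees_constK polyCD. Qed.

Lemma rees_constM a b : rees_const (a * b) = rees_const a * rees_const b.
Proof. by apply: rees_val_inj; rewrite rees_valM !rees_constK polyCM. Qed.

Lemma rees_const0 : rees_const 0 = 0.
Proof. by apply: rees_val_inj; rewrite rees_val0 rees_constK. Qed.

Lemma rees_const1 : rees_const 1 = 1.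
Proof. by apply: rees_val_inj; rewrite rees_val1 rees_constK. Qed.

Lemma rees_const_sum (T : finType) (F : T -> R) :
  rees_const (\sum_i F i) = \sum_i rees_const (F i).
Proof. exact: (big_morph _ rees_constD rees_const0). Qed.

Lemma rees_const_max a : m a -> rees_max I m (rees_const a).
Proof.
by move=> ma; apply: sub_ideal_span; exists a => //; rewrite rees_constK.
Qed.

Lemma rees_monoD n a b : ideal_exp I n a -> ideal_exp I n b ->
  rees_mono I n (a + b) = rees_mono I n a + rees_mono I n b.
Proof.
move=> Ia Ib; apply: rees_val_inj; rewrite rees_valD !rees_monoK ?scalerDl //.
exact: idealD.
Qed.

Lemma rees_mono0 n : rees_mono I n 0 = 0.
Proof.
by apply: rees_val_inj; rewrite rees_val0 rees_monoK ?scale0r //; apply: ideal0.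
Qed.

Lemma rees_monoM i j a b : ideal_exp I i a -> ideal_exp I j b ->
  rees_mono I i a * rees_mono I j b = rees_mono I (i + j) (a * b).
Proof.
move=> Ia Ib; apply: rees_val_inj; rewrite rees_valM !rees_monoK //.
  by rewrite -scalerAl -scalerAr scalerA exprD.
exact: mem_ideal_expM.
Qed.

Definition rsub_closed (V : set B) := [/\ rees_max I m `<=` V,
  (forall f g, V f -> V g -> V (f + g)) &
  forall a f, V f -> V (rees_const a * f)].

(* the [R]-submodule of [R[It]] generated by [X] and [m R[It]] *)
Definition rees_span (X : set B) : set B :=
  [set f | forall V, rsub_closed V -> X `<=` V -> V f].

Lemma rees_span_closed X : rsub_closed (rees_span X).
Proof.
split=> [f mf V [mV _ _] _|f g Xf Xg V cV XV|a f Xf V cV XV]; first exact: mV.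
- by case: (cV) => _ VD _; apply: VD; [apply: Xf|apply: Xg].
- by case: (cV) => _ _ VM; apply: VM; apply: Xf.
Qed.

Lemma rees_span_sub X : X `<=` rees_span X.
Proof. by move=> f Xf V _; apply. Qed.

Lemma rsub_closed0 V : rsub_closed V -> V 0.
Proof. by case=> mV _ _; apply: mV; apply: ideal0. Qed.

Lemma rsub_closed_sum V (T : Type) (r : seq T) (F : T -> B) : rsub_closed V ->
  (forall i, V (F i)) -> V (\sum_(i <- r) F i).
Proof.
move=> cV VF; elim/big_ind: _ => //; first exact: rsub_closed0.
by case: cV.
Qed.

Lemma rees_span_mono n (gs : seq R) a X : rsub_closed X ->
  ideal_exp I n = ideal_span [set` gs] ->
  (forall x, x \in gs -> X (rees_mono I n x)) ->
  ideal_exp I n a -> X (rees_mono I n a).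
Proof.
move=> cX en gX; have [_ XD XM] := cX.
have cK : ideal_closed [set a | ideal_exp I n a /\ X (rees_mono I n a)].
  split=> [|x y [Ix Xx] [Iy Xy]|x y [Iy Xy]].
  - by split; [apply: ideal0|rewrite rees_mono0; apply: rsub_closed0].
  - by split; [apply: idealD|rewrite rees_monoD //; apply: XD].
  - split; first exact: idealM.
    by rewrite -[n]add0n -rees_monoM //; apply: XM.
rewrite {1}en => /(_ (Ideal cK)) H.
suff [] : Ideal cK a by [].
apply: H => x xg; split; last exact: gX.
by rewrite en; apply: sub_ideal_span.
Qed.

Lemma rees_low_generators n : noetherian R -> exists E : seq B,
  forall k a X, (k <= n)%N -> rsub_closed X -> [set` E] `<=` X ->
    ideal_exp I k a -> X (rees_mono I k a).
Proof.
move=> hR; elim: n => [|n [E IH]].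
  exists [:: 1] => k a X; rewrite leqn0 => /eqP-> cX EX _.
  have [_ _ XM] := cX; rewrite -/(rees_const a) -[rees_const a]mulr1.
  by apply/XM/EX; apply: mem_head.
have [gs egs] := hR (ideal_exp I n.+1).
exists (E ++ map (rees_mono I n.+1) gs) => k a X kn cX EX.
have [|kgt] := leqP k n.
  move=> {}kn; apply: IH => // f fE; apply: EX.
  by rewrite /= mem_cat (fE : f \in E).
have -> : k = n.+1 by apply/eqP; rewrite eqn_leq kn.
apply: (rees_span_mono cX egs) => x xg; apply: EX.
by rewrite /= mem_cat map_f ?orbT.
Qed.

Variables (s : seq R) (n0 : nat) (E : seq B).
Hypothesis sI : [set` s] `<=` I.
Hypothesis hE : forall k a X, (k <= n0)%N -> rsub_closed X -> [set` E] `<=` X ->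
  ideal_exp I k a -> X (rees_mono I k a).
Hypothesis redI : ideal_exp I n0.+1 `<=`
  ideal_lin 1 (ideal_mul (ideal_span [set` s]) (ideal_exp I n0))
              (ideal_mul m (ideal_exp I n0.+1)).

Definition rees_generator n : set B := [set f | exists (b : 'I_(size s) -> nat) l,
  [/\ (forall i, b i <= n)%N, l \in E &
     f = (\prod_(i < size s) rees_mono I 1 s`_i ^+ b i) * l]].

(** Above degree [n0] the reduction hypothesis pulls out one factor from [s] at the cost of an
    element of m R[It]; up to degree [n0] the finite list [E] does the work. The bound n on each
    exponent is crude but gives a box that is easy to count. *)
Lemma rees_mono_span n a : ideal_exp I n a ->
  rees_span (rees_generator n) (rees_mono I n a).
Proof.
have base n' : [set` E] `<=` rees_generator n'.
  move=> f fE; exists (fun=> 0%N), f; split=> //.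
  by rewrite big1 ?mul1r.
elim: n a => [|n IH] a Ia.
  apply: (hE (X := rees_span _)) => //; first exact: rees_span_closed.
  by move=> f /(base 0%N); apply: rees_span_sub.
have [nn0|n0n] := leqP n.+1 n0.
  apply: (hE (X := rees_span _)) => //; first exact: rees_span_closed.
  by move=> f /(base n.+1); apply: rees_span_sub.
have [b [c [sb mc ->]]] : ideal_lin 1
    (ideal_mul (ideal_span [set` s]) (ideal_exp I n))
    (ideal_mul m (ideal_exp I n.+1)) a.
  have swap k K j : ideal_mul (ideal_exp I k) (ideal_mul K (ideal_exp I j)) =
      ideal_mul K (ideal_exp I (k + j)).
    by rewrite ideal_mulA (ideal_mulC _ K) -ideal_mulA ideal_expD.
  have := Ia; rewrite -(subnK n0n) -ideal_expD.
  move=> /(ideal_mulS (fun _ => id) redI)/mul_ideal_lin.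
  by rewrite !swap subSS subnK // addnS subnK.
have Ib : ideal_exp I n.+1 b.
  by apply: ideal_mulS sb => //; apply: ideal_span_le.
have [mS SD SM] := rees_span_closed (rees_generator n.+1).
rewrite mul1r rees_monoD //; last exact: ideal_mul_ler mc.
apply: (SD); last first.
  apply: mS; apply/rees_maxP => i; rewrite rees_monoK;
    last exact: ideal_mul_ler mc.
  rewrite coefZ coefXn; case: eqP => [->|_]; first by rewrite mulr1.
  by rewrite mulr0; apply: ideal0.
move: sb; rewrite ideal_mulC => /mul_span_sum[d [Id eb]].
have -> : rees_mono I n.+1 b =
    \sum_(j < size s) rees_mono I 1 s`_j * rees_mono I n (d j).
  have Is (j : 'I_(size s)) : ideal_exp I 1 s`_j.
    by rewrite ideal_exp1; apply: sI; apply: mem_nth.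
  under eq_bigr => j _ do rewrite rees_monoM //.
  apply: rees_val_inj; rewrite rees_monoK // rees_val_sum eb scaler_suml.
  apply: eq_bigr => j _; rewrite rees_monoK; first by rewrite mulrC.
  exact: (mem_ideal_expM (Is j) (Id j)).
apply: (rsub_closed_sum (V := rees_span _)) => [|j];
  first exact: rees_span_closed.
(* The span is an intersection of submodules, so the induction hypothesis is used on the submodule
   of those [f] whose product with the degree-one element of s_j lies in the target span. *)
apply: (IH _ (Id j) [set f | rees_span _ (rees_mono I 1 s`_j * f)]).
  split=> [f mf|f g Sf Sg|r f Sf]; rewrite /mkset.
  - by apply: mS; apply: idealM.
  - by rewrite mulrDr; apply: SD.
  - by rewrite mulrCA; apply: SM.
move=> _ [e [l [en lE ->]]]; apply: rees_span_sub.
exists (fun i => e i + (i == j))%N, l; split=> // [i|].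
  by case: eqP => _; rewrite ?addn1 ?addn0 ?ltnS // ltnW // ltnS.
rewrite mulrA; congr (_ * _).
under [RHS]eq_bigr => i _ do rewrite exprD.
rewrite big_split mulrC; congr (_ * _).
rewrite (bigD1 j) //= eqxx expr1 big1 ?mulr1 // => i ij.
by rewrite (negPf ij) expr0.
Qed.

Definition rees_box M : finType := ({ffun 'I_(size s) -> 'I_M} * 'I_(size E))%type.

Definition rees_box_val M (t : rees_box M) : B :=
  (\prod_(i < size s) rees_mono I 1 s`_i ^+ t.1 i) * E`_t.2.

Definition in_rees_box M (f : B) := exists c : rees_box M -> R,
  rees_max I m (f - \sum_t rees_const (c t) * rees_box_val t).

Lemma in_rees_box_closed M : rsub_closed (in_rees_box M).
Proof.
split=> [f mf|f g [c mc] [d md]|a f [c mc]].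
- exists (fun=> 0); rewrite big1 ?subr0 // => t _.
  by rewrite rees_const0 mul0r.
- exists (fun t => c t + d t).
  move: (idealD mc md); congr (ideal_set _ _).
  rewrite addrACA -opprD -big_split; congr (_ - _).
  by apply: eq_bigr => t _; rewrite rees_constD mulrDl.
- exists (fun t => a * c t).
  move: (idealM (rees_const a) mc); congr (ideal_set _ _).
  rewrite mulrBr mulr_sumr; congr (_ - _).
  by apply: eq_bigr => t _; rewrite rees_constM mulrA.
Qed.

Lemma size_in_rees_box M (f : B) : (size (rees_val f) <= M)%N ->
  in_rees_box M f.
Proof.
move=> fM; have -> : f = \sum_(n < M) rees_mono I n (rees_val f)`_n.
  apply: rees_ext => n; rewrite rees_val_sum coef_sum.
  under eq_bigr => i _ do
    rewrite (rees_monoK (rees_coef f i)) coefZ coefXn.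
  have [nM|Mn] := ltnP n M.
    rewrite (bigD1 (Ordinal nM)) //= eqxx mulr1 big1 ?addr0 // => i ni.
    rewrite (_ : (n == i) = false) ?mulr0 //.
    by apply: contraNF ni => /eqP ni; apply/eqP/val_inj.
  rewrite nth_default ?(leq_trans fM) // big1 // => i _.
  by rewrite gtn_eqF ?mulr0 // (leq_trans (ltn_ord i)).
apply: (rsub_closed_sum (V := in_rees_box M)) => [|n];
  first exact: in_rees_box_closed.
apply: (rees_mono_span (rees_coef f n)); first exact: in_rees_box_closed.
move=> _ [b [l [bn lE ->]]].
have bM i : (b i < M)%N by apply: leq_ltn_trans (bn i) _.
have lE' : (index l E < size E)%N by rewrite index_mem.
pose t0 : rees_box M := ([ffun i => Ordinal (bM i)], Ordinal lE').
exists (fun t => (t == t0)%:R).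
rewrite (bigD1 t0) // eqxx rees_const1 mul1r [X in _ - (_ + X)]big1 ?addr0;
  last first.
  by move=> t tt0; rewrite (negPf tt0) rees_const0 mul0r.
have -> : rees_box_val t0 = (\prod_(i < size s) rees_mono I 1 s`_i ^+ b i) * l.
  rewrite /rees_box_val /= nth_index //; congr (_ * _).
  by apply: eq_bigr => i _; rewrite ffunE.
by rewrite subrr; apply: ideal0.
Qed.

End ReesSpan.

(** * The theorem *)

Lemma size_mon (R : comNzRingType) (I : ideal R) N D k
    (x : nat -> rees_algebra I) (j : expo N k) :
  (forall i, (i < k)%N -> (size (rees_val (x i)) <= D)%N) ->
  (size (rees_val (mon x j)) <= (D * N * k).+1)%N.
Proof.
elim: k x j => [|k IH] x j xD; first by rewrite rees_val1 size_poly1 muln0.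
have IHj := IH (fun i => x i.+1) j.2 (fun i => xD i.+1).
rewrite [mon x j]/= rees_valM (leq_trans (size_polyMleq _ _)) //.
have x0 : (size (rees_val (x 0%N ^+ j.1)) <= (D * N).+1)%N.
  have -> : rees_val (x 0%N ^+ j.1) = rees_val (x 0%N) ^+ j.1.
    by elim: (nat_of_ord j.1) => [|n IHn];
      rewrite ?rees_val1 // !exprS rees_valM IHn.
  apply: leq_trans (size_poly_exp_leq _ _) _; rewrite ltnS.
  apply: leq_mul; last exact: ltnW.
  exact: leq_trans (leq_pred _) (xD 0%N isT).
rewrite -subn1 leq_subLR; apply: leq_trans (leq_add x0 IHj) _.
by rewrite mulnS addSn addnS.
Qed.

(* If the chain were longer than [size s], elements of the successive
   differences [P i.+1 \ P i] would be algebraically independent modulo [m];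
   but their monomials of degree [< N] in each variable, [N ^ (size s).+1] in
   number, lie in the span of [O(N ^ size s)] elements. *)
Lemma rees_prime_chain_le (R : comNzRingType) (m I : ideal R) (s : seq R) n0 k
    (P : nat -> ideal (rees_algebra I)) :
  noetherian R -> local_ring m -> [set` s] `<=` I ->
  ideal_exp I n0.+1 `<=`
    ideal_lin 1 (ideal_mul (ideal_span [set` s]) (ideal_exp I n0))
                (ideal_mul m (ideal_exp I n0.+1)) ->
  prime_chain k P -> rees_max I m `<=` P 0%N -> (k <= size s)%N.
Proof.
move=> hR hm sI redI Pc mP; rewrite leqNgt; apply/negP => sk.
set h := size s in sk.
have {}Pc : prime_chain h.+1 P.
  by case: Pc => Pp PS; split=> i ih;
    [apply/Pp/(leq_trans ih)|apply/PS/(leq_trans ih)].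
have /choice[x xP] i : exists x : rees_algebra I,
    (i < h.+1)%N -> P i.+1 x /\ ~ P i x.
  have [ih|] := boolP (i < h.+1)%N; last by exists 0.
  by have [x Px nPx] := ideal_properP (Pc.2 i ih); exists x.
have [E hE] := rees_low_generators m I n0 hR.
pose D := (\max_(i < h.+1) size (rees_val (x i)))%N.
have xD i : (i < h.+1)%N -> (size (rees_val (x i)) <= D)%N.
  move=> ih;
    exact: (@leq_bigmax_cond _ _ (fun i : 'I_h.+1 => size (rees_val (x i))) (Ordinal ih)).
(* Monomials with exponents below [N] have size at most M <= (D (h+1) + 1) N. Hence the box has at
   most |E| (D (h+1) + 1)^h N^h elements, fewer than N^(h+1) for this [N]. *)
pose N := (size E * (D * h.+1).+1 ^ h).+1.
pose M := (D * N * h.+1).+1.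
have /choice[c cE] (j : expo N h.+1) :=
  size_in_rees_box sI hE redI (size_mon j xD : (_ <= M)%N).
have count : (#|rees_box s E M| < #|expo N h.+1|)%N.
  rewrite card_expo card_prod card_ffun !card_ord expnS -/h.
  have MN : (M <= (D * h.+1).+1 * N)%N.
    by rewrite /M mulSn mulnAC addnC -addn1 leq_add2l.
  apply: (@leq_ltn_trans (((D * h.+1).+1 * N) ^ h * size E)).
    rewrite leq_mul2r; apply/orP; right.
    have expS e a b : (a <= b)%N -> (a ^ e <= b ^ e)%N.
      by case: e => [|e]; rewrite ?expn0 // leq_exp2r.
    exact: expS.
  by rewrite expnMn mulnAC ltn_mul2r expn_gt0 /= mulnC /N ltnSn.
(* [c j] holds the box coordinates of the j-th monomial. A combination [d] with all coordinates in
   [m] is an element of m R[It], so independence forces every [d j] into [m]. *)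
have [d [[j dj] md]] := local_dependence hm c count.
apply: dj; apply: (prime_chain_independent (phi := rees_const I) Pc xP).
- by move=> a ma; apply/mP/rees_const_max.
- move=> a Pa; apply: contrapT => /(local_unit hm)[v av].
  have [P1 _] := Pc.1 h.+1 (leqnn _); apply: P1.
  by rewrite -(rees_const1 I) -av rees_constM; apply: idealMr.
apply: mP.
have -> : \sum_j rees_const I (d j) * mon x j =
    \sum_j rees_const I (d j) *
      (mon x j - \sum_t rees_const I (c j t) * rees_box_val t)
    + \sum_t rees_const I (\sum_j d j * c j t) * rees_box_val t.
  under [X in _ = _ + X]eq_bigr => t _ do rewrite rees_const_sum mulr_suml.
  rewrite exchange_big -big_split; apply: eq_bigr => i _ /=.
  rewrite mulrBr mulr_sumr.
  under [X in _ = _ + X]eq_bigr => t _ do rewrite rees_constM -mulrA.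
  by rewrite subrK.
apply: idealD; apply: ideal_sum => i _; first exact: idealM.
by apply/idealMr/rees_const_max.
Qed.

(** By Nakayama the image of [K] in J / m J is a proper subspace, hence inside a hyperplane. The
    hyperplane is [G t], where a :: t is a shortest list of entries of [z] generating [J] together
    with K + m J. *)
Lemma sub_span_fewer (A : comPzRingType) (m K : ideal A) (z : seq A) :
  local_ring m -> K `<=` ideal_span [set` z] -> K <> ideal_span [set` z] ->
  exists2 s : seq A, (size s < size z)%N &
    [set` s] `<=` ideal_span [set` z] /\
    K `<=` ideal_lin 1 (ideal_span [set` s]) (ideal_mul m (ideal_span [set` z])).
Proof.
set J := ideal_span _ => hm KJ KneJ.
pose K' := ideal_lin 1 K (ideal_mul m J).
pose G (t : seq A) := ideal_lin 1 K' (ideal_span [set` t]).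
pose b n := `[< exists t, [/\ {subset t <= z}, size t = n & J `<=` G t] >].
have [|n /asboolP[t [tz <- JG]] nmin] := @ex_minnP b.
  by exists (size z); apply/asboolP; exists z; split=> // x; apply: mem_lin_r.
case: t tz JG nmin => [|a t] tz JG nmin.
  case: KneJ; apply: ideal_le_anti => //.
  apply: (nakayama hm) => i iz; have := JG _ (mem_span_nth iz).
  move=> [_ [y [[k [l [Kk ml ->]]] /span_nil-> ->]]].
  by exists k, l; split=> //; ring.
have Ka : ~ G t a.
  move=> Ga; suff : (size (a :: t) <= size t)%N by rewrite ltnn.
  apply: nmin; apply/asboolP; exists t; split=> // [x xt|x /JG].
    by apply: tz; rewrite inE xt orbT.
  apply: (@ideal_lin_le _ _ _ _ (G t)) => [y|]; first exact: mem_lin_l.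
  apply: ideal_span_le => y yt; have {yt} : y \in a :: t := yt.
  by rewrite inE => /predU1P[-> //|yt]; apply/mem_lin_r/sub_ideal_span.
have Ja y : J y -> exists r, G t (y - r * a).
  move=> /JG[k [l [Kk + ->]]]; rewrite -[a :: t]cat0s span_middle cat0s.
  move=> [r [l' [_ tl' ->]]]; exists r.
  have -> : 1 * k + (a * r + l') - r * a = 1 * k + l' by ring.
  by exists k, l'.
have az : a \in z by apply: tz; apply: mem_head.
have {}Ja y : exists r, J y -> G t (y - r * a).
  by have [/Ja[r]|] := pselect (J y); [exists r|exists 0].
have [r rE] := choice Ja.
pose j := index a z; pose rest := take j z ++ drop j.+1 z.
have jz : (j < size z)%N by rewrite index_mem.
have ez : z = take j z ++ a :: drop j.+1 z.
  by rewrite -{1}(nth_index 0 az) -drop_nth // cat_take_drop.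
have restz : {subset rest <= z}.
  move=> x; rewrite [in X in _ -> X]ez !(mem_cat, inE).
  by case/orP=> ->; rewrite ?orbT.
(* Projection of the other entries of [z] along [a] onto the hyperplane. With [a] they still
   generate [J], and an element of [K] has its coefficient of [a] in [m], as [a] would otherwise lie
   in [G t]. *)
pose s := map (fun y => y - r y * a) rest.
have Ja1 : J a by apply: sub_ideal_span.
exists s.
  by rewrite size_map [X in (_ < size X)%N]ez !size_cat /= addnS.
split=> [_ /mapP[y /restz yz ->]|x Kx].
  by apply: idealB; [apply: sub_ideal_span|apply: idealM].
have [c [y [_ sy ex]]] : ideal_lin a (unit_ideal A) (ideal_span [set` s]) x.
  have := KJ x Kx; rewrite /J ez span_middle.
  apply: ideal_lin_le => [w _|]; first exact: mem_lin_l.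
  apply: ideal_span_le => w wr.
  rewrite -[X in ideal_set _ X](subrK (r w * a)) addrC [r w * a]mulrC.
  apply: idealD; first exact: mem_lin_l.
  by apply: mem_lin_r; apply: sub_ideal_span; rewrite mulrC; apply: (map_f _ wr).
have Gs : ideal_span [set` s] `<=` G t.
  apply: ideal_span_le => _ /mapP[w /restz wz ->].
  by apply: rE; apply: sub_ideal_span.
exists y, (a * c); split=> //; last by rewrite ex; ring.
rewrite mulrC; apply: mem_ideal_mul => //;
  apply: contrapT => /(local_unit hm)[v cv].
apply: Ka; have -> : a = v * (x - y).
  by rewrite ex addrK mulrCA (mulrC v) cv mulr1.
apply/idealM/idealB; last exact: Gs.
rewrite -[x]mul1r; apply: mem_lin_l; rewrite -[x]mul1r; exact: mem_lin_l.
Qed.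

Theorem theorem2p3 (R : comNzRingType) (m : ideal R)
    (hCM : cohen_macaulay_local m)
    (p : ideal R) (hp : prime_ideal p) (g : nat) (hg : prime_height p g)
    (hnreg : ~ regular_local_ring (localization hp))
    (z : g.-tuple R) (hz : regular_sequence z)
    (hzp : [set` z] `<=` p) :
  let J := ideal_span [set` z] in
  let I := ideal_colon J p in
  equimultiple I m /\ reduction_number I 1.
Proof.
move=> J I; have [hR hm _] := hCM; have [reg _] := hz.
have hgz : prime_height p (size z) by rewrite size_tuple.
have JI : J `<=` I by apply: span_sub_link.
have Ip : I `<=` p by apply: (link_sub_prime hR hgz hzp hnreg).
have pm : p `<=` m by apply: (proper_sub_local hm); have [] := hp.
have I2 : ideal_exp I 2 = ideal_mul J (ideal_exp I 1).
  exact: (link_square hR hgz reg hzp hnreg).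
have IneJ : I <> J by apply: (link_neq_span hR hp hgz reg hzp).
have zI : [set` z] `<=` I by move=> x xz; apply/JI/sub_ideal_span.
have zm : [set` z] `<=` m by move=> x /hzp/pm.
have redI n : ideal_exp I n.+1 `<=` ideal_mul (ideal_exp J n) I.
  elim: n => [|n IH]; first by rewrite ideal_exp1 ideal_mul1.
  rewrite ideal_expE => x /(ideal_mulS (fun _ => id) IH).
  rewrite ideal_mulA (ideal_mulC I) -ideal_mulA -{2}(ideal_exp1 I).
  by rewrite -ideal_expE I2 ideal_mulA (ideal_mulC _ J) ideal_exp1.
have [P Pc mP] := rees_prime_chain hR (maximal_proper hm) reg zm zI redI.
have minJ : minimal_reduction J I.
  split=> [|K [KI [n eK]] KJ]; first by split=> //; exists 1%N.
  apply: contrapT => KneJ.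
  have [s sz [sJ Ks]] := sub_span_fewer hm KJ KneJ.
  suff : (size z <= size s)%N by rewrite leqNgt sz.
  apply: (rees_prime_chain_le (n0 := n) hR hm _ _ Pc mP).
    by move=> x /sJ/JI.
  (* I^(n+1) = K I^n lies in (s) I^n + m J I^n, and J I^n is inside I^(n+1): [s] satisfies the
     reduction hypothesis modulo [m], with too few elements for the chain [P]. *)
  rewrite {1}eK ideal_mulC => x /(ideal_mulS (fun _ => id) Ks)/mul_ideal_lin.
  move=> [a [b [sa mb ->]]]; exists a, b; split=> //.
    by rewrite ideal_mulC.
  move: mb; rewrite ideal_mulC -ideal_mulA; apply: ideal_mulS => //.
  exact: ideal_mulS.
split.
  exists (size z); last exact: height_link.
  split; first exact: prime_chain_quot_image Pc mP.
  move=> k Q Qc.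
  (* Here [z] itself is the reduction and n0 = 1 because I^2 = J I, so the correction term in [m] is
     zero. *)
  apply: (rees_prime_chain_le (n0 := 1) hR hm zI _ (prime_chain_quot_preim Qc)).
    by move=> x; rewrite {1}I2 => Jx; rewrite -[x]mul1r; apply: mem_lin_l.
  exact: sub_quot_preim.
split.
  exists J => //; split=> // -[|//].
  by rewrite ideal_exp1 ideal_mul_exp0.
(* Reduction number 0 would mean I = J'; then [J] is a reduction inside the minimal reduction [J'],
   which forces J = I. *)
move=> J' [|//] [_ J'min] [+ _]; rewrite ideal_exp1 ideal_mul_exp0 => eI.
case: IneJ; rewrite eI; apply/esym/J'min; last by rewrite -eI.
by split=> //; exists 1%N.
Qed.
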